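(* There is an integer $k$ such that for every positive integer $m$, every bipartite $3$-choosable-critical graph is $(4mk:2mk)$-choosable.
   Context: A graph $G$ is $(a:b)$-choosable if for every list assignment $L$ with $|L(v)|=a$ for all $v$, there is a function $f$ assigning each vertex $v$ a $b$-subset $f(v)\subseteq L(v)$ with $f(u)\cap f(v)=\emptyset$ for each edge $uv$; $2$-choosable means $(2:1)$-choosable. A graph is $3$-choosable-critical if it is not $2$-choosable but all its proper subgraphs are $2$-choosable. *)

(* Defs.v *)
From mathcomp Require Import all_boot.
Set Implicit Arguments.
Unset Strict Implicit.
Unset Printing Implicit Defensive.

Record sgraph := SGraph {
  vertex :> finType;
  edge : rel vertex;
  edge_sym : symmetric edge;
  edge_irrefl : irreflexive edge }.

Definition bipartite (G : sgraph) : Prop :=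
  exists c : G -> bool, forall u v : G, edge u v -> c u != c v.

(* The palette [C] is an arbitrary finite type: as [G] is finite, the union
   of the lists of a list assignment is always a finite set. *)
Definition choosable (G : sgraph) (a b : nat) : Prop :=
  forall (C : finType) (L : G -> {set C}),
    (forall v : G, #|L v| = a) ->
    exists f : G -> {set C},
      (forall v : G, f v \subset L v /\ #|f v| = b) /\
      (forall u v : G, edge u v -> [disjoint f u & f v]).

Definition two_choosable (G : sgraph) : Prop := choosable G 2 1.

(* Not necessarily induced, and with possibly fewer vertices than [G]. *)
Record subgraph (G : sgraph) := Subgraph {
  sub_verts : {set G};
  sub_edge : rel G;
  sub_edge_sym : symmetric sub_edge;
  sub_edgeP : forall u v : G,
    sub_edge u v -> [/\ u \in sub_verts, v \in sub_verts & edge u v] }.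

Definition proper_subgraph (G : sgraph) (H : subgraph G) : Prop :=
  sub_verts H != [set: G] \/ exists u v : G, edge u v /\ ~~ sub_edge H u v.

Section SubgraphAsGraph.
Variables (G : sgraph) (H : subgraph G).

Definition sg_edge : rel {x : G | x \in sub_verts H} :=
  fun u v => sub_edge H (val u) (val v).

Lemma sg_edge_sym : symmetric sg_edge.
Proof. by move=> u v; apply: sub_edge_sym. Qed.

Lemma sg_edge_irrefl : irreflexive sg_edge.
Proof.
move=> u; apply/negP => /sub_edgeP[_ _].
by rewrite edge_irrefl.
Qed.

Definition graph_of_subgraph : sgraph := SGraph sg_edge_sym sg_edge_irrefl.

End SubgraphAsGraph.

Definition three_choosable_critical (G : sgraph) : Prop :=
  ~ two_choosable G /\
  forall H : subgraph G, proper_subgraph H ->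
    two_choosable (graph_of_subgraph H).

(* Main.v *)
Require Import Defs.
From mathcomp Require Import all_boot zify.
From Stdlib Require Import Classical_Prop.
Set Implicit Arguments.
Unset Strict Implicit.
Unset Printing Implicit Defensive.

(** Put [n = 2mk] and let all lists have size [2n].  If a set [A] of colours
    contains exactly half of every list, then giving [A :&: L v] to one side of
    the bipartition and [L v :\: A] to the other is a colouring.  The types of
    the colours with respect to boundedly many lists form a finite set, so by
    Dickson's lemma such an [A] exists as soon as [k] is a multiple of a
    constant depending only on the number of lists.

    A critical graph may be arbitrarily large, but it is a union of at most four
    internally disjoint paths (ears) between at most two vertices.  Indeed two
    cycles sharing at most one vertex, a theta graph other than the one with
    path lengths 2, 2, 2p, and a union of four ears of length at least 2 between
    two vertices all have lists of size 2 without colouring, so a critical graph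
    containing one of them is equal to it; and adding an ear to the theta graph
    with lengths 2, 2, 2p always creates one of them.

    Finally, whether colour sets of size [n] at the ends of a path with an odd
    number of inner vertices extend to the path is controlled by one weight
    function of total [2n]: it suffices that a set of colours containing both
    end sets has weight at most [n].  Halving the lists of the ends of the ears
    and these weights simultaneously involves only boundedly many weights. *)

(** * Halving finitely many weights *)

Lemma subset_of_card (C : finType) (A : {set C}) k :
  k <= #|A| -> exists2 B : {set C}, B \subset A & #|B| = k.
Proof.
move=> kA; exists [set x in take k (enum A)].
  apply/subsetP => x; rewrite inE => /mem_take.
  by rewrite mem_enum.
rewrite cardsE; have /card_uniqP -> : uniq (take k (enum A)).
  by rewrite take_uniq // enum_uniq.
by rewrite size_takel // -cardE.
Qed.

(** Dickson's lemma, by induction on the coordinates in [r]. A finite basis for the other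
    coordinates settles every [x] whose coordinate [t] reaches the maximum of the basis there; the
    finitely many smaller values are treated slice by slice. *)
Lemma dickson (T : finType) (r : seq T) (P : {ffun T -> nat} -> Prop) :
  exists2 s : seq {ffun T -> nat}, {in s, forall g, P g} &
    forall x, P x -> exists2 g, g \in s & {in r, forall t, g t <= x t}.
Proof.
elim: r P => [|t r IHr] P.
  case: (classic (exists x, P x)) => [[x Px]|nP]; last first.
    by exists [::] => // x Px; case: nP; exists x.
  exists [:: x] => [g|y _]; first by rewrite inE => /eqP->.
  by exists x; rewrite ?inE.
have below M : exists2 s : seq {ffun T -> nat}, {in s, forall g, P g} &
    forall x, P x -> x t < M ->
      exists2 g, g \in s & {in t :: r, forall t', g t' <= x t'}.
  elim: M => [|M [s sP sM]]; first by exists [::].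
  have [s' s'P s'M] := IHr (fun x => P x /\ x t = M).
  exists (s ++ s') => [g|x Px].
    by rewrite mem_cat => /orP[/sP//|/s'P[]].
  rewrite ltnS leq_eqVlt => /orP[/eqP xM|/(sM _ Px)[g gs gx]]; last first.
    by exists g; rewrite // mem_cat gs.
  have [g gs gx] := s'M x (conj Px xM).
  exists g => [|t']; first by rewrite mem_cat gs orbT.
  rewrite inE => /orP[/eqP->|/gx//].
  by have [_ ->] := s'P _ gs; rewrite xM.
have [s sP sx] := IHr P.
have [s' s'P s'M] := below (\max_(g <- s) (g t)).
exists (s ++ s') => [g|x Px].
  by rewrite mem_cat => /orP[/sP|/s'P].
have [/(s'M _ Px)[g gs gx]|Mx] := ltnP (x t) (\max_(g <- s) g t).
  by exists g; rewrite // mem_cat gs orbT.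
have [g gs gx] := sx x Px.
exists g => [|t']; first by rewrite mem_cat gs.
rewrite inE => /orP[/eqP->|/gx//].
by apply: leq_trans Mx; apply: leq_bigmax_seq.
Qed.

Section Balanced.

Variables (T J : finType) (wt : T -> J -> nat) (j0 : J).
Implicit Types x y g : {ffun T -> nat}.

(** Read [x] as a multiset of colour types; halving means finding a sub-multiset on which all
    weights agree again. *)
Definition balanced x d := forall j, \sum_t x t * wt t j = d.

Lemma balanced_sub x g d d' : balanced x d -> balanced g d' ->
  (forall t, g t <= x t) ->
  d' <= d /\ balanced [ffun t => x t - g t] (d - d').
Proof.
move=> bx bg gx; split.
  by rewrite -(bx j0) -(bg j0); apply: leq_sum => t _; rewrite leq_mul2r gx orbT.
move=> j; rewrite -(bx j) -(bg j) -sumnB; last first.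
  by move=> t _; rewrite leq_mul2r gx orbT.
by apply: eq_bigr => t _; rewrite ffunE mulnBl.
Qed.

(** By Dickson's lemma finitely many balanced vectors of positive total generate the totals of all
    balanced ones. A large total forces many copies of one generator, and some number of them has
    total exactly [K], a common multiple of the generators' totals. The reserve of [r] blocks keeps
    this pigeonhole argument valid at each extraction. *)
Lemma balanced_blocks : exists K r, [/\ 0 < K, 0 < r &
  forall i x d, balanced x d -> (i + r) * K <= d ->
    exists2 y : {ffun T -> nat}, (forall t, y t <= x t) & balanced y (i * K)].
Proof.
pose deg x := \sum_t x t * wt t j0.
have degE x d : balanced x d -> deg x = d by move/(_ j0).
have [s0 s0P s0min] :=
  dickson (enum T) (fun x => exists2 d, 0 < d & balanced x d).
pose s := undup s0.
have sP g : g \in s -> 0 < deg g /\ balanced g (deg g).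
  by rewrite mem_undup => /s0P[d d0 bg]; rewrite (degE _ _ bg).
have smin x d : balanced x d -> 0 < d ->
    exists2 g, g \in s & forall t, g t <= x t.
  move=> bx d0; have [|g gs gx] := s0min x; first by exists d.
  by exists g => [|t]; rewrite ?mem_undup // gx // mem_enum.
pose K := \prod_(g <- s) deg g.
have K0 : 0 < K.
  by rewrite /K big_seq prodn_cond_gt0 // => g /sP[].
have degK g : g \in s -> deg g %| K.
  by move=> gs; rewrite /K (big_rem g) //= dvdn_mulr.
(* Generators are subtracted greedily; their positive totals make the remaining total decrease to
   0. *)
have peel d : forall x, balanced x d -> exists2 a : {ffun T -> nat} -> nat,
    forall t, \sum_(g <- s) a g * g t <= x t & \sum_(g <- s) a g * deg g = d.
  elim/ltn_ind: d => d IHd x bx.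
  have [->|d0] := posnP d.
    by exists (fun=> 0) => [t|]; rewrite big1.
  have [g gs gx] := smin x d bx d0; have [dg0 bg] := sP g gs.
  have [dgd bxg] := balanced_sub bx bg gx.
  have [|a ax ad] := IHd (d - deg g) _ _ bxg; first by lia.
  have sum1 F : \sum_(h <- s) (a h + (h == g)) * F h
      = \sum_(h <- s) a h * F h + F g.
    rewrite (eq_bigr (fun h => a h * F h + (h == g) * F h)); last first.
      by move=> h _; rewrite mulnDl.
    rewrite big_split; congr (_ + _).
    rewrite (bigD1_seq g) ?undup_uniq //= eqxx mul1n big1 ?addn0 //.
    by move=> h /negPf->.
  exists (fun h => a h + (h == g)) => [t|]; last by rewrite sum1 ad; lia.
  rewrite (sum1 (fun h => h t)) /=; move: (ax t) (gx t); rewrite ffunE => axt gxt.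
  by rewrite addnC -leq_subRL.
have block x d : balanced x d -> (size s).+1 * K <= d ->
    exists2 y : {ffun T -> nat}, (forall t, y t <= x t) & balanced y K.
  move=> bx Kd; have [a ax ad] := peel d x bx.
  have /hasP[g gs gK] : has (fun g => K <= a g * deg g) s.
    apply/negPn/negP => /hasPn small.
    have : \sum_(g <- s) a g * deg g <= \sum_(g <- s) K.
      rewrite big_seq [X in _ <= X]big_seq; apply: leq_sum => g /small.
      by rewrite -ltnNge => /ltnW.
    by rewrite ad big_const_seq count_predT iter_addn_0; lia.
  have [dg0 bg] := sP g gs.
  exists [ffun t => K %/ deg g * g t] => [t|j].
    rewrite ffunE; apply: leq_trans (ax t).
    rewrite (big_rem g) //=; apply: leq_trans (leq_addr _ _).
    by rewrite leq_mul2r leq_divLR ?degK // gK orbT.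
  under eq_bigr do rewrite ffunE -mulnA.
  by rewrite -big_distrr /= bg divnK // degK.
exists K, (size s).+1; split=> //; elim=> [|i IHi] x d bx id.
  by exists [ffun=> 0] => [t|j]; rewrite ?ffunE // big1 // => t _; rewrite ffunE.
have [|y yx by_] := block x d bx; first by nia.
have [_ bz] := balanced_sub bx by_ yx.
have [|z zx bz'] := IHi _ _ bz; first by move: id; rewrite addSn mulSn; lia.
exists [ffun t => y t + z t] => [t|j].
  by rewrite ffunE; move: (yx t) (zx t); rewrite ffunE; lia.
under eq_bigr do rewrite ffunE mulnDl.
by rewrite big_split /= by_ bz' mulSn.
Qed.

End Balanced.

(** Colours are classified by their vector of weights. The number of such types is bounded in terms
    of [N] and [D], so balanced blocks apply to the multiset of types, and picking the right number
    of colours of each type turns blocks into a set. *)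
Lemma halving (N D : nat) : exists2 k, 0 < k &
  forall m (C : finType) (I : eqType) (s : seq I) (w : I -> C -> nat),
    0 < m -> size s <= N -> {in s, forall i c, w i c <= D} ->
    {in s, forall i, \sum_c w i c = 4 * m * k} ->
    exists A : {set C}, {in s, forall i, \sum_(c in A) w i c = 2 * m * k}.
Proof.
(* One index more than [N] makes [J] inhabited; [idx] below lets the surplus indices repeat the
   first weight. *)
pose J := 'I_N.+1; pose T := {ffun J -> 'I_D.+1}.
have [K [r [K0 r0 blk]]] :=
  balanced_blocks (fun (t : T) (j : J) => t j : nat) ord0.
exists (r * K) => [|m C I [|i0 s'] w' m0]; first by rewrite muln_gt0 r0.
  by exists set0.
move: (i0 :: s') (isT : 0 < size (i0 :: s')) => s s0 sN sD sE.
pose idx j := nth i0 s (if j < size s then j else 0).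
have idxP j : idx j \in s by apply: mem_nth; case: ifP.
pose w j := w' (idx j).
pose ty c : T := [ffun j : J => inord (w j c)].
have tyE c j : ty c j = w j c :> nat.
  by rewrite ffunE inordK // ltnS sD.
pose x := [ffun t => #|[set c | ty c == t]|].
have sumty (F : T -> nat) (A : {set C}) :
    \sum_(c in A) F (ty c) = \sum_t #|[set c in A | ty c == t]| * F t.
  rewrite (partition_big ty predT) //=; apply: eq_bigr => t _.
  rewrite -sum_nat_const; apply: eq_big => [c|c /andP[_ /eqP->]//].
  by rewrite inE.
have bx : balanced (fun (t : T) (j : J) => t j : nat) x (4 * m * (r * K)).
  move=> j; rewrite -(sE _ (idxP j)) -/(w j).
  transitivity (\sum_(c in [set: C]) ty c j : nat).
    rewrite (sumty (fun t => t j : nat)); apply: eq_bigr => t _.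
    by rewrite ffunE; congr (#|pred_of_set _| * _); apply/setP => c; rewrite !inE.
  by apply: eq_big => c; rewrite ?inE.
(* Half of the [4 * m * r] blocks of size [K] are extracted; the reserve of [r] blocks fits because
   [0 < m]. *)
have [|y yx by_] := blk (2 * m * r) x _ bx; first by nia.
have /fin_all_exists[sel selP] t : exists B : {set C},
    B \subset [set c | ty c == t] /\ #|B| = y t.
  by have := yx t; rewrite ffunE => /subset_of_card[B]; exists B.
pose A := [set c | c \in sel (ty c)].
exists A => i is_.
have iN : index i s < N.+1 by rewrite -index_mem in is_; lia.
have wi : w' i = w (Ordinal iN) by rewrite /w /idx /= index_mem is_ nth_index.
rewrite wi mulnA -(by_ (Ordinal iN)).
rewrite -(eq_bigr _ (fun c _ => tyE c (Ordinal iN))).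
rewrite (sumty (fun t : T => t (Ordinal iN) : nat)); apply: eq_bigr => t _.
have [/subsetP sub <-] := selP t; congr (#|pred_of_set _| * _).
apply/setP => c; rewrite !inE; apply/andP/idP => [[cs /eqP<-//]|cs].
by move: (sub _ cs); rewrite inE => /eqP tyc; rewrite tyc eqxx.
Qed.

(** * Paths with an odd number of inner vertices *)

(* Linear inequalities between cardinals of Boolean combinations are checked
   colour by colour. *)
Ltac pointwise_with tac :=
  rewrite -!sum1_card ![\sum_(_ in _) 1]big_mkcond -?big_split /=;
  apply: leq_sum; let c := fresh "c" in move=> c _; rewrite !inE; tac c;
  repeat match goal with |- context [c \in ?A] => case: (c \in A) end.
Ltac pointwise := pointwise_with ltac:(fun _ => idtac).
Ltac pointwise_using H := pointwise_with ltac:(fun c => move: (H c)).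

Section OddPaths.

Variables (C : finType) (n : nat).
Implicit Types A B L P Q S T X Y : {set C}.

(** Colours outside [B] are taken first, and [B] only fills up the shortage. *)
Lemma subset_avoiding Y B : n <= #|Y| -> exists f : {set C},
  [/\ f \subset Y, #|f| = n & #|f :&: B| = n - #|Y :\: B|].
Proof.
move=> nY; have [nYB|YBn] := leqP n #|Y :\: B|.
  have [f fYB fn] := subset_of_card nYB.
  exists f; split=> //; first exact: subset_trans fYB (subsetDl _ _).
  apply/eqP; rewrite (eqP nYB) cards_eq0; apply/eqP/setP => c; rewrite !inE.
  by apply/andP => -[/(subsetP fYB)]; rewrite inE => /andP[/negPf->].
have [|f fYB fn] := @subset_of_card _ (Y :&: B) (n - #|Y :\: B|).
  by have := cardsID B Y; lia.
have fB : f \subset B by apply: subset_trans fYB (subsetIr _ _).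
exists ((Y :\: B) :|: f); split.
- by rewrite subUset subsetDl (subset_trans fYB (subsetIl _ _)).
- rewrite cardsU; suff -> : (Y :\: B) :&: f = set0 by rewrite cards0; lia.
  apply/setP => c; rewrite !inE; apply/andP => -[/andP[/negP cB _] /(subsetP fB)].
  exact: cB.
- rewrite -fn; congr #|pred_of_set _|; apply/setP => c; rewrite !inE.
  have [/(subsetP fB)->|_] := boolP (c \in f); first by rewrite orbT.
  by rewrite orbF; case: (c \in B); rewrite ?andbF.
Qed.

(** [f1] takes as little as possible of [L :\: B], so that many colours outside [B] remain for [f2].
    The two bounds on [#|L :&: B|] serve the cases where [f1] avoids [L :\: B] entirely and where it
    cannot. *)
Lemma two_step Y L B z : n <= #|Y| -> #|L| = n + n ->
  #|L :&: B| <= z + n -> #|L :&: B| <= z + #|Y :\: (L :\: B)| ->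
  exists f1 f2 : {set C}, [/\ f1 \subset Y, #|f1| = n, f2 \subset L :\: f1,
    #|f2| = n & #|f2 :&: B| <= z].
Proof.
move=> nY L2 zn zY.
have [f1 [f1Y f1n f1B]] := subset_avoiding (L :\: B) nY.
have [|f2 [f2L f2n f2B]] := @subset_avoiding (L :\: f1) B.
  by have := cardsID f1 L; have := subset_leq_card (subsetIr L f1); lia.
exists f1, f2; split=> //; rewrite f2B.
have := cardsID B L.
have : #|L :\: B| + 0 <= #|(L :\: f1) :\: B| + #|f1 :&: (L :\: B)| by rewrite addn0; pointwise.
by lia.
Qed.

Definition load P Q X S T := #|P :&: S| + #|Q :&: T| + #|X :&: (S :|: T)|.

(** Discarding one element from one of the sets lowers the load by at most one. *)
Lemma trim_load P Q X : exists P' Q' X' : {set C},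
  [/\ P' \subset P, Q' \subset Q, X' \subset X,
      #|P'| + #|Q'| + #|X'| <= n + n &
      forall S T, load P Q X S T
        <= load P' Q' X' S T + (#|P| + #|Q| + #|X| - (n + n))].
Proof.
pose p := minn #|P| (n + n); pose q := minn #|Q| (n + n - p).
pose x := minn #|X| (n + n - p - q).
have [|P' P'P P'p] := @subset_of_card _ P p; first by rewrite /p; lia.
have [|Q' Q'Q Q'q] := @subset_of_card _ Q q; first by rewrite /q; lia.
have [|X' X'X X'x] := @subset_of_card _ X x; first by rewrite /x; lia.
exists P', Q', X'; split=> // [|S T]; first by rewrite /p /q /x in P'p Q'q X'x; lia.
have cut (A' A B : {set C}) :
    A' \subset A -> #|A :&: B| + #|A'| <= #|A' :&: B| + #|A|.
  move=> A'A; have <- : #|A'| + #|A :\: A'| = #|A|.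
    by rewrite -[in RHS](cardsID A' A) (setIidPr A'A).
  have : #|A :&: B| + 0 <= #|A' :&: B| + #|A :\: A'| by rewrite addn0; pointwise.
  by lia.
have := cut _ _ S P'P; have := cut _ _ T Q'Q; have := cut _ _ (S :|: T) X'X.
by rewrite /load /p /q /x in P'p Q'q X'x *; lia.
Qed.

Definition disj : rel {set C} := fun A B => [disjoint A & B].

(* [P] (resp. [Q]) collects colours blocked only from the left (resp. right)
   end, [X] those blocked from either end. *)
Lemma odd_path_load (Ls : seq {set C}) :
  odd (size Ls) -> all (fun L : {set C} => #|L| == n + n) Ls ->
  exists P Q X : {set C}, [/\ [disjoint P & X], [disjoint Q & X],
    #|P| + #|Q| + #|X| <= n + n &
    forall S T, #|S| <= n -> #|T| <= n -> load P Q X S T <= n ->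
      exists hs : seq {set C},
        all2 (fun h L : {set C} => (h \subset L) && (#|h| == n)) hs Ls
        /\ path disj S (rcons hs T)].
Proof.
move=> oddLs; have [l lE] : exists l, size Ls = l.*2.+1.
  by exists (size Ls)./2; have := odd_double_half (size Ls); rewrite oddLs.
elim: l Ls lE {oddLs} => [|l IHl] [|L1 [|L2 Ls]] //=.
  rewrite andbT => _ /eqP L12.
  (* With a single inner vertex, every colour of its list can be blocked from either end. *)
  exists set0, set0, L1; rewrite -!setI_eq0 !set0I !cards0; split=> //; first lia.
  move=> S T Sn Tn; rewrite /load !set0I !cards0 !add0n => LST.
  have [|h hL hn] := @subset_of_card _ (L1 :\: (S :|: T)) n.
    by have := cardsID (S :|: T) L1; lia.
  exists [:: h]; rewrite /= /disj hn eqxx !andbT.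
  rewrite (subset_trans hL (subsetDl _ _)); split=> //.
  by apply/andP; split; apply/pred0P => c /=; apply/andP => -[];
    [move=> cS /(subsetP hL)|move=> /(subsetP hL) + cS];
    rewrite !inE cS ?orbT.
move=> [lE] /and3P[/eqP L12 /eqP L22 Ls2].
have [P [Q [X [PX QX PQX IH]]]] := IHl Ls lE Ls2.
have {}PX c : c \in P -> c \in X -> false by move=> cP; rewrite (disjointFr PX).
have {}QX c : c \in Q -> c \in X -> false by move=> cP; rewrite (disjointFr QX).
(* The first two inner vertices receive [f1] and [f2], and induction treats the rest with [f2] as
   left end. Colours of [X] outside [L2] cannot occur in [f2], so only the right end blocks them.
   Colours of [L1 :\: L2], which [f1] can use at no cost to [f2], become blocked from the left. *)
pose P0 := (L1 :\: L2) :|: (L1 :&: L2 :&: P).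
pose Q0 := Q :|: (X :\: L2); pose X0 := L1 :&: L2 :&: X.
have [P1 [Q1 [X1 [P10 Q10 X10 PQX1 trim]]]] := trim_load P0 Q0 X0.
exists P1, Q1, X1; split=> //.
- apply/pred0P => c /=; apply/andP => -[/(subsetP P10) + /(subsetP X10)].
  rewrite !inE; move: (PX c).
  by case: (c \in P); case: (c \in X); case: (c \in L1); case: (c \in L2) => // /(_ isT isT).
- apply/pred0P => c /=; apply/andP => -[/(subsetP Q10) + /(subsetP X10)].
  rewrite !inE; move: (QX c).
  by case: (c \in Q); case: (c \in X); case: (c \in L1); case: (c \in L2) => // /(_ isT isT).
move=> S T Sn Tn load1; have {load1}load0 := leq_trans (trim S T) (leq_add load1 (leqnn _)).
(* The colours whose use in [f2] adds to the load of the remaining path; [X :&: T] is counted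
   already. *)
pose B := P :|: (X :\: T).
pose k1 := #|(L2 :\: L1) :&: P|; pose k2 := #|(L2 :\: L1) :&: X|.
have PQ_X c : ~~ ((c \in P) && (c \in X)) && ~~ ((c \in Q) && (c \in X)).
  by apply/andP; split; apply/andP => -[]; [move/PX|move/QX] => /[apply].
have QT : #|Q :&: T| + #|X :&: T| <= #|T| + 0.
  by rewrite addn0; pointwise_using PQ_X.
have k12 : k1 + k2 <= #|L2 :\: L1| by rewrite /k1 /k2; pointwise_using PQ_X.
have L21 : #|L2 :\: L1| = #|L1 :\: L2|.
  by have := cardsID L1 L2; have := cardsID L2 L1; rewrite setIC; lia.
have tot : #|P0| + #|Q0| + #|X0| + k1 + k2 <= #|L1 :\: L2| + #|P| + #|Q| + #|X|.
  by rewrite /P0 /Q0 /X0 /k1 /k2; pointwise.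
have key : #|L2 :&: B| + #|Q :&: T| + #|X :&: T| + #|L1 :\: L2|
    <= #|(L1 :\: S) :\: (L2 :\: B)| + load P0 Q0 X0 S T + k1 + k2.
  by rewrite /load /P0 /Q0 /X0 /k1 /k2 /B !addnA; pointwise_using PQ_X.
have lB : #|L2 :&: B| + #|X :&: T| <= #|P| + #|X| by rewrite /B; pointwise.
(* The target for [f2 :&: B] is what the limit [n] leaves after the contribution of [T]; by [QT]
   this subtraction is not truncated. *)
have [||||f1 [f2 [f1Y f1n f2L f2n f2B]]] :=
    @two_step (L1 :\: S) L2 B (n - (#|Q :&: T| + #|X :&: T|)).
- by have := cardsID S L1; have := subset_leq_card (subsetIr L1 S); lia.
- by [].
- by have := subset_leq_card (subsetIl Q T); lia.
- by lia.
have [||hs [hsL hsP]] := IH f2 T _ Tn; first by rewrite f2n.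
  have : load P Q X f2 T <= #|f2 :&: B| + #|Q :&: T| + #|X :&: T|.
    by rewrite /load /B; pointwise_using PQ_X.
  by lia.
exists [:: f1, f2 & hs]; rewrite /= f1n f2n eqxx hsL hsP !andbT.
rewrite (subset_trans f1Y (subsetDl _ _)) (subset_trans f2L (subsetDl _ _)).
split=> //; rewrite /disj disjoint_sym.
rewrite (disjointWl f1Y) /=; last by rewrite -setI_eq0 setIDAC setDIl setDv setI0.
by rewrite disjoint_sym (disjointWl f2L) // -setI_eq0 setIDAC setDIl setDv setI0.
Qed.

(** When [S] and [T] lie in [A], the load is at most the weight of [A] under the sum of the
    indicators of [P], [Q] and [X]. A fourth set [Z] pads the total to exactly [n + n], as halving
    requires, whence the bound 4. *)
Lemma odd_path_weight (Ls : seq {set C}) :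
  odd (size Ls) -> all (fun L : {set C} => #|L| == n + n) Ls ->
  exists w : C -> nat, [/\ forall c, w c <= 4, \sum_c w c = n + n &
    forall A S T, #|S| <= n -> #|T| <= n -> S \subset A -> T \subset A ->
      \sum_(c in A) w c <= n ->
      exists hs : seq {set C},
        all2 (fun h L : {set C} => (h \subset L) && (#|h| == n)) hs Ls
        /\ path disj S (rcons hs T)].
Proof.
move=> oddLs Ls2; have [P [Q [X [_ _ tot ext]]]] := odd_path_load oddLs Ls2.
have [|Z _ Zn] := @subset_of_card C [set: C] (n + n - (#|P| + #|Q| + #|X|)).
  case: Ls oddLs Ls2 {ext} => //= L Ls _ /andP[/eqP L2 _].
  by have := subset_leq_card (subsetT L); lia.
pose w c := (c \in P) + (c \in Q) + (c \in X) + (c \in Z).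
have sumw A : \sum_(c in A) w c = #|P :&: A| + #|Q :&: A| + #|X :&: A| + #|Z :&: A|.
  rewrite !big_split /= -!sum1_card; congr (_ + _ + _ + _);
  by rewrite big_mkcond [RHS]big_mkcond /=; apply: eq_bigr => c _; rewrite inE;
    case: (c \in A) (c \in P) (c \in Q) (c \in X) (c \in Z) => -[] [] [] [].
exists w; split=> [c||A S T Sn Tn SA TA].
- by rewrite /w; case: (c \in P) (c \in Q) (c \in X) (c \in Z) => -[] [] [].
- have := sumw setT; rewrite !setIT Zn => sT.
  transitivity (\sum_(c in [set: C]) w c); last by rewrite sT; lia.
  by apply: eq_bigl => c; rewrite inE.
rewrite sumw => wn; apply: ext => //; rewrite /load.
have := subset_leq_card (setIS P SA); have := subset_leq_card (setIS Q TA).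
have STA : S :|: T \subset A by rewrite subUset SA.
by have := subset_leq_card (setIS X STA); lia.
Qed.

End OddPaths.

(** * Ear systems *)

Lemma path_zip (T : eqType) (r : rel T) x p :
  path r x p -> {in zip (x :: p) p, forall uv, r uv.1 uv.2}.
Proof.
elim: p x => [|y p IHp] x //= /andP[rxy /IHp yp] uv.
by rewrite inE => /orP[/eqP->|/yp].
Qed.

Lemma seq_choice (I : eqType) (X : Type) (d : X) (R : I -> X -> Prop) (s : seq I) :
  {in s, forall i, exists w, R i w} -> exists F : I -> X, {in s, forall i, R i (F i)}.
Proof.
elim: s => [|i s IHs] ex; first by exists (fun=> d).
have [|F FP] := IHs; first by move=> j js; apply: ex; rewrite inE js orbT.
have [w wP] := ex i (mem_head _ _).
exists (fun j => if j == i then w else F j) => j.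
by rewrite inE; case: eqVneq => [->|_] //= /FP.
Qed.

(** Local solutions on disjoint domains are merged; [d] supplies the values elsewhere. *)
Lemma glue (V I : eqType) (X : Type) (d : V -> X) (dom : I -> seq V)
    (Q : I -> (V -> X) -> Prop) (s : seq I) :
  uniq (flatten [seq dom i | i <- s]) ->
  (forall i f f', {in dom i, f =1 f'} -> Q i f -> Q i f') ->
  {in s, forall i, exists f, Q i f} ->
  exists f, {in s, forall i, Q i f} /\
    forall v, v \notin flatten [seq dom i | i <- s] -> f v = d v.
Proof.
move=> + Qext; elim: s => [|i s IHs] /=; first by exists d.
rewrite cat_uniq => /and3P[_ /hasPn dis us] ex.
have [//||f [fQ fd]] := IHs; first by move=> j js; apply: ex; rewrite inE js orbT.
have [g gQ] := ex i (mem_head _ _).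
exists (fun v => if v \in dom i then g v else f v); split=> [j|v].
  rewrite inE => /orP[/eqP->|js]; first by apply: Qext gQ => v /= ->.
  apply: Qext (fQ j js) => v vj /=; rewrite ifN //; apply: dis.
  by apply/flattenP; exists (dom j) => //; apply: map_f.
by rewrite mem_cat negb_or => /andP[/negPf-> /fd].
Qed.

Section Ears.

Variable G : sgraph.
Implicit Types (x y z u v : G) (xs ys zs : seq G) (W : seq G).

Definition ear := (G * seq G * G)%type.
Implicit Types (e : ear) (es : seq ear).

Definition inner e := e.1.2.

Definition walk x xs y := path (@edge G) x (rcons xs y).

Definition ear_edges e := zip (e.1.1 :: rcons e.1.2 e.2) (rcons e.1.2 e.2).

(** Uniqueness of the whole concatenation makes the ears internally disjoint and keeps their inner
    vertices out of [W]. The two ends of an ear may coincide, which makes it a cycle. *)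
Definition ear_system W es :=
  uniq (W ++ flatten [seq inner e | e <- es]) &&
  all (fun e => [&& e.1.1 \in W, e.2 \in W & walk e.1.1 e.1.2 e.2]) es.

Definition ear_rel es : rel G := fun u v =>
  has (fun e => ((u, v) \in ear_edges e) || ((v, u) \in ear_edges e)) es.

Definition covers es := forall u v, edge u v -> ear_rel es u v.

Lemma walk_cat x xs y ys z : walk x (xs ++ y :: ys) z = walk x xs y && walk y ys z.
Proof. by rewrite /walk -cats1 -catA cat_path /= rcons_path cats1 andbA. Qed.

Lemma walk_color (c : G -> bool) x xs y :
  (forall u v, edge u v -> c u != c v) -> walk x xs y ->
  c y = (c x (+) ~~ odd (size xs)).
Proof.
move=> cP; elim: xs x => [|z xs IHxs] x.
  by rewrite /walk /= andbT => /cP; case: (c x); case: (c y).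
rewrite -[z :: xs]cat0s walk_cat => /andP[+ /IHxs->] /=.
by rewrite /walk /= andbT => /cP; case: (c x); case: (c z); case: odd.
Qed.

(** A positive even number of inner vertices is repaired by cutting at the first one, into an edge
    and an odd ear. *)
Definition ear_split e : seq ear :=
  if e.1.2 is z :: xs then
    if odd (size xs) then [:: (e.1.1, [::], z); (z, xs, e.2)] else [:: e]
  else [:: e].

Definition ear_split_point e : seq G :=
  if e.1.2 is z :: xs then if odd (size xs) then [:: z] else [::] else [::].

(** Prepares for [odd_path_weight], which treats odd ears only; each cut costs one branch vertex and
    one ear. *)
Lemma refine_ear_system W es : ear_system W es -> covers es ->
  exists W' es', [/\ size W' <= size W + size es, size es' <= (size es).*2,
    ear_system W' es', covers es' &
    all (fun e => (inner e == [::]) || odd (size (inner e))) es'].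
Proof.
move=> /andP[uW esW] cov.
exists (W ++ flatten [seq ear_split_point e | e <- es]), (flatten [seq ear_split e | e <- es]).
split.
- rewrite size_cat leq_add2l {uW esW cov}.
  elim: es => [|e es IHes] //=; rewrite size_cat.
  suff : size (ear_split_point e) <= 1 by lia.
  by case: e => -[x [|z xs]] y; rewrite /ear_split_point //=; case: ifP.
- elim: es {uW esW cov} => [|e es IHes] //=; rewrite size_cat.
  suff : size (ear_split e) <= 2 by lia.
  by case: e => -[x [|z xs]] y; rewrite /ear_split //=; case: ifP.
- apply/andP; split.
    suff /perm_uniq-> : perm_eq ((W ++ flatten [seq ear_split_point e | e <- es]) ++
        flatten [seq inner e | e <- flatten [seq ear_split e | e <- es]])
        (W ++ flatten [seq inner e | e <- es]) by [].
    apply/permP => f; rewrite !count_cat -addnA; congr (_ + _).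
    elim: es {uW esW cov} => [|e es IHes] //=.
    rewrite map_cat flatten_cat !count_cat -IHes.
    suff -> : count f (inner e) = count f (ear_split_point e)
        + count f (flatten [seq inner e' | e' <- ear_split e])
      by rewrite addnACA.
    case: e => -[x [|z xs]] y; rewrite /ear_split /ear_split_point /inner //=.
    by case: ifP => _ /=; rewrite ?cats0; lia.
  apply/allP => e' /flatten_mapP[e ees] e'e.
  have ptW z : z \in ear_split_point e ->
      z \in flatten [seq ear_split_point e | e <- es].
    by move=> ze; apply/flatten_mapP; exists e.
  move: (allP esW _ ees) e'e ptW; rewrite !mem_cat.
  case: e {ees} => -[x [|z xs]] y; rewrite /ear_split /ear_split_point /=.
    by case/and3P=> xW yW w; rewrite inE => /eqP-> _ /=; rewrite xW yW.
  case: ifP => _ /and3P[xW yW w]; rewrite ?inE; last first.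
    by move=> /eqP-> _ /=; rewrite xW yW.
  move=> + /(_ z (mem_head _ _)) zW; move: w; rewrite -[z :: xs]cat0s walk_cat.
  by case/andP=> w1 w2 /orP[]/eqP-> /=; rewrite ?xW ?yW zW ?w1 ?w2 ?orbT.
- move=> u v /cov /hasP[e ees uve].
  suff /hasP[e' e'e uve'] : has (fun e' =>
      ((u, v) \in ear_edges e') || ((v, u) \in ear_edges e')) (ear_split e).
    by apply/hasP; exists e' => //; apply/flatten_mapP; exists e.
  case: e uve {ees} => -[x [|z xs]] y; rewrite /ear_split /=; first by rewrite orbF.
  case: ifP => _ /=; rewrite ?orbF // /ear_edges /= !inE.
  by case/orP=> /orP[->|->]; rewrite ?orbT.
- apply/allP => e' /flatten_mapP[-[[x [|z xs]] y] _]; rewrite /ear_split /=.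
    by rewrite inE => /eqP->.
  case: ifP => o; rewrite !inE; last by move=> /eqP->; rewrite /inner /= o ?orbT.
  by move=> /orP[]/eqP->; rewrite /inner //= o ?orbT.
Qed.

End Ears.

(** One set [A] halves the lists of the branch vertices and the weights of the odd ears. One class
    of branch vertices uses colours in [A], the other colours outside [A], and [odd_path_weight]
    extends this along each odd ear. *)
Lemma ear_system_choosable (p q : nat) : exists2 k, 0 < k &
  forall m (G : sgraph) W (es : seq (ear G)), 0 < m -> bipartite G ->
    size W <= p -> size es <= q -> ear_system W es -> covers es ->
    choosable G (4 * m * k) (2 * m * k).
Proof.
(* After refinement there are at most [p + q] branch vertices and [q.*2] ears, with one weight each,
   bounded by 4. *)
have [k k0 half] := halving (p + q + q.*2) 4; exists k => // m G W0 es0 m0 [c cP] Wp esq.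
move=> sys0 cov0 C L L2; set n := 2 * m * k.
have {}L2 v : #|L v| = n + n by rewrite L2 /n; lia.
have [W [es [Wsz essz /andP[uW esW] cov es_odd]]] := refine_ear_system sys0 cov0.
have esP e : e \in es ->
    [/\ e.1.1 \in W, e.2 \in W, walk e.1.1 e.1.2 e.2 & (inner e == [::]) || odd (size (inner e))].
  by move=> ees; have /and3P[? ? ?] := allP esW _ ees; rewrite (allP es_odd _ ees).
have sumL v (A : {set C}) : \sum_(c in A) ((c \in L v) : nat) = #|L v :&: A|.
  rewrite -sum1_card big_mkcond [RHS]big_mkcond; apply: eq_bigr => a _.
  by rewrite inE; case: (a \in A) (a \in L v) => -[].
have sumLT v : \sum_c ((c \in L v) : nat) = n + n.
  by rewrite -(L2 v) -[L v in RHS]setIT -sumL; apply: eq_bigl => a; rewrite inE.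
have [|wt wtP] := @seq_choice _ (C -> nat) (fun=> 0)
  (fun e w => [/\ forall c, w c <= 4, \sum_c w c = n + n &
     odd (size (inner e)) -> forall A S T : {set C}, #|S| <= n -> #|T| <= n ->
       S \subset A -> T \subset A -> \sum_(c in A) w c <= n ->
       exists hs : seq {set C},
        all2 (fun h L : {set C} => (h \subset L) && (#|h| == n)) hs (map L (inner e))
        /\ path (@disj C) S (rcons hs T)]) es.
  move=> e ees; have [odde|] := boolP (odd (size (inner e))).
    have [||w [w4 w2 wP]] := @odd_path_weight C n (map L (inner e)).
    - by rewrite size_map.
    - by apply/allP => _ /mapP[v _ ->]; rewrite L2.
    by exists w; split.
  (* A single edge gets the list of its first end as a placeholder with the right total. *)
  by exists (fun a => a \in L e.1.1); split=> // a; case: (_ \in _).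
pose w (i : G + ear G) : C -> nat := match i with
  | inl v => fun a => a \in L v | inr e => wt e end.
have [|||A AP] := half m C _ ([seq inl v | v <- W] ++ [seq inr e | e <- es]) w m0.
- by rewrite size_cat !size_map; lia.
- move=> i; rewrite mem_cat => /orP[]/mapP[j js ->] a /=; first by case: (_ \in _).
  by have [] := wtP _ js.
- move=> i; rewrite mem_cat => /orP[]/mapP[j js ->] /=.
    by rewrite sumLT /n; lia.
  by have [_ -> _] := wtP _ js; rewrite /n; lia.
have AV v : v \in W -> #|L v :&: A| = n.
  by move=> vW; rewrite -sumL (AP (inl v)) // mem_cat map_f.
have AE e : e \in es -> \sum_(c in A) wt e c = n.
  by move=> ees; rewrite (AP (inr e)) // mem_cat map_f ?orbT.
pose side (b : bool) := if b then A else ~: A.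
pose base v := L v :&: side (c v).
have base_card v : v \in W -> #|base v| = n.
  move=> vW; rewrite /base /side; case: ifP => _; first exact: AV.
  by have := cardsID A (L v); rewrite AV // L2 setDE; lia.
(* The complement of [A] has weight [n] too, since the total is [n + n]. *)
have sideE e b : e \in es -> \sum_(c in side b) wt e c = n.
  move=> ees; rewrite /side; case: b; first exact: AE.
  have [_ + _] := wtP e ees; rewrite (bigID (mem A)) /= AE // => /addnI <-.
  by apply: eq_bigl => a; rewrite inE.
have /fin_all_exists[d0 d0P] v : exists h : {set C}, h \subset L v /\ #|h| = n.
  by have [|h] := @subset_of_card _ (L v) n; [rewrite L2; lia | exists h].
(* [d0] takes care of the vertices outside the ear system. *)
pose d v := if v \in W then base v else d0 v.
pose Q (e : ear G) (h : G -> {set C}) :=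
  path (@disj C) (base e.1.1) (rcons (map h (inner e)) (base e.2)) /\
  {in inner e, forall v, h v \subset L v /\ #|h v| = n}.
have uin : uniq (flatten [seq inner e | e <- es]).
  by move: uW; rewrite cat_uniq => /and3P[].
have [||f [fQ fd]] := @glue _ _ _ d (@inner G) Q es uin.
- move=> e h h' hh' [hp hL]; split; last by move=> v ve; rewrite -hh' //; apply: hL.
  by have /eq_in_map <- := hh'.
- move=> e ees; have [xW yW wk] := esP e ees.
  case: (boolP (inner e == [::])) => [/eqP e0 _|_ /= oe].
    exists d; rewrite /Q e0 /=; split=> //; rewrite andbT.
    move: wk; rewrite -/(inner e) e0 /walk /= andbT => /cP cc.
    rewrite /disj -setI_eq0 /base setIACA /side.
    suff -> : side (c e.1.1) :&: side (c e.2) = set0 by rewrite setI0.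
    by rewrite /side; case: (c e.1.1) (c e.2) cc => -[] //; rewrite ?setICr // setIC setICr.
  (* The ends of an odd ear are in the same class, so both end sets lie in the same half of the
     colours. *)
  have cxy : c e.2 = c e.1.1 by rewrite (walk_color cP wk) -/(inner e) oe addbF.
  have [_ _ /(_ oe (side (c e.1.1)) (base e.1.1) (base e.2))] := wtP e ees.
  case; rewrite ?base_card ?sideE ?subsetIr //; first by rewrite -cxy subsetIr.
  move=> hs [hsL hsP].
  have ue : uniq (inner e).
    elim: (es) ees uin => //= e' s IHs; rewrite inE cat_uniq.
    by move=> /orP[/eqP<- /and3P[]//|/IHs H /and3P[_ _ /H]].
  have szhs : size hs = size (inner e).
    by move: hsL; rewrite all2E size_map => /andP[/eqP].
  exists (fun v => nth set0 hs (index v (inner e))); split.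
    suff -> : [seq nth set0 hs (index v (inner e)) | v <- inner e] = hs by [].
    apply: (@eq_from_nth _ set0); rewrite size_map // => i ie.
    by rewrite (nth_map e.1.1) // index_uniq.
  move=> v ve; move: hsL; rewrite all2E => /andP[_ /allP/(_ (nth set0 hs (index v (inner e)), L v))].
  have iv : index v (inner e) < size (inner e) by rewrite index_mem.
  case/(_ _)/andP => [|-> /eqP->//].
  have -> : L v = nth set0 (map L (inner e)) (index v (inner e)).
    by rewrite (nth_map e.1.1) // nth_index.
  rewrite -nth_zip ?size_map //; apply: mem_nth.
  by rewrite size_zip size_map szhs minnn.
have fW v : v \in W -> f v = base v.
  move=> vW; rewrite fd /d ?vW //; apply/negP => vin.
  by move: uW; rewrite cat_uniq => /and3P[_ /hasPn/(_ v vin)]; rewrite vW.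
exists f; split=> [v|u v].
  have [/flatten_mapP[e ees ve]|vn] := boolP (v \in flatten [seq inner e | e <- es]).
    by have [_ /(_ v ve)] := fQ e ees.
  by rewrite fd // /d; case: ifP => // vW; rewrite base_card // subsetIl.
move=> /cov /hasP[e ees uve].
have [pe _] := fQ e ees; have [xW yW _ _] := esP e ees.
move: pe; rewrite -!fW // -map_rcons path_map => /path_zip pe.
case/orP: uve => /pe //=; rewrite /disj /=.
by rewrite disjoint_sym.
Qed.

(** * Critical graphs and lists without a colouring *)

Section Critical.

Variable G : sgraph.
Hypothesis critG : three_choosable_critical G.

(** [r] defines a spanning subgraph, proper because it lacks [uv]; its sets of size 1 are read as
    colours. *)
Lemma critical_spanning (r : rel G) u v (C : finType) (L : G -> {set C}) :
  symmetric r -> subrel r (@edge G) -> edge u v -> ~~ r u v ->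
  (forall w, #|L w| = 2) ->
  exists g : G -> C, (forall w, g w \in L w) /\ forall w w', r w w' -> g w != g w'.
Proof.
move=> rsym rsub uv nruv L2.
have rP a b : r a b -> [/\ a \in [set: G], b \in [set: G] & edge a b].
  by move=> rab; rewrite !inE rsub.
pose H := Subgraph rsym rP.
have [|f [fL fd]] := critG.2 H _ C (fun w => L (val w)) (fun w => L2 (val w)).
  by right; exists u, v.
have inT w : w \in sub_verts H by rewrite inE.
have /fin_all_exists[g gP] w : exists a, f (Sub w (inT w)) = [set a].
  by apply/cards1P; rewrite (fL _).2.
exists g; split=> [w|w w' rww'].
  by apply: (subsetP (fL (Sub w (inT w))).1); rewrite gP set11.
have := fd (Sub w (inT w)) (Sub w' (inT w')) rww'.
rewrite !gP; apply: contraTneq => ->.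
by rewrite -setI_eq0 setIid -cards_eq0 cards1.
Qed.

Lemma critical_lists : exists (C : finType) (L : G -> {set C}),
  (forall w, #|L w| = 2) /\
  forall g : G -> C, (forall w, g w \in L w) ->
    exists u v, edge u v && (g u == g v).
Proof.
apply: NNPP => nL; case: critG => + _; apply=> C L L2.
apply: NNPP => nf; apply: nL; exists C, L; split=> // g gL.
apply: NNPP => ng; apply: nf; exists (fun v => [set g v]); split=> [v|u v uv].
  by rewrite sub1set gL cards1.
rewrite disjoints1 inE; apply/negP => guv; apply: ng; exists u, v.
by rewrite uv guv.
Qed.

(** If [v] were the only neighbour of [u], a colouring of the graph without the edges at [u] would
    extend to [u], whose list has a colour other than that of [v]. *)
Lemma critical_degree (u v : G) : edge u v -> exists2 w, edge u w & w != v.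
Proof.
move=> uv; have [C [L [L2 bad]]] := critical_lists.
apply: NNPP => nw.
have uniq_v w : edge u w -> w = v.
  by move=> uw; apply/eqP/negPn/negP => wv; apply: nw; exists w.
pose r w w' := edge w w' && (u \notin [:: w; w']).
have [|w w' /andP[]||g [gL gr]] := @critical_spanning r u v C L _ _ uv _ L2.
- by move=> w w'; rewrite /r edge_sym !inE orbC.
- by [].
- by rewrite /r !inE eqxx andbF.
have /set0Pn[a] : L u :\ g v != set0.
  rewrite -cards_eq0; have := cardsD1 (g v) (L u); rewrite L2.
  by case: (g v \in L u); lia.
rewrite !inE => /andP[agv aL].
have [|w [w' /andP[]]] := bad (fun w => if w == u then a else g w).
  by move=> w; case: eqP => [->|].
rewrite /=; case: (eqVneq w u) => [->|wu]; case: (eqVneq w' u) => [->|w'u].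
- by rewrite edge_irrefl.
- by move=> /uniq_v->; rewrite (negPf agv).
- by rewrite edge_sym => /uniq_v->; rewrite eq_sym (negPf agv).
by move=> ww'; apply/negP/gr; rewrite /r ww' !inE !(eq_sym u) negb_or wu.
Qed.

(** Otherwise the component of [u] and the rest both contain an edge, so each is coloured inside a
    proper subgraph and the two colourings combine. *)
Lemma critical_connected (u u' v v' : G) : edge u u' -> edge v v' -> connect (@edge G) u v.
Proof.
move=> uu' vv'; apply/negPn/negP => nuv.
have [C [L [L2 bad]]] := critical_lists.
have csym := @sym_connect_sym _ (@edge G) (@edge_sym G).
pose X := connect (@edge G) u.
have Xe w w' : edge w w' -> X w = X w'.
  by move=> ww'; apply: (same_connect_r csym); apply: connect1.
have part b : exists g : G -> C, (forall w, g w \in L w) /\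
    forall w w', edge w w' && (X w == b) -> g w != g w'.
  have [a [a' [aa' Xa]]] : exists a a', edge a a' /\ X a = ~~ b.
    case: b; first by exists v, v'; split=> //=; apply: negbTE.
    by exists u, u'; rewrite /X connect0.
  apply: (critical_spanning _ _ aa' _ L2).
  - by move=> w w'; rewrite edge_sym; case: (boolP (edge w' w)) => // /Xe->.
  - by move=> w w' /andP[].
  - by rewrite Xa aa'; case: b {Xa}.
have [[g1 [g1L g1P]] [g2 [g2L g2P]]] := (part true, part false).
have [|w [w' /andP[ww']]] := bad (fun w => if X w then g1 w else g2 w).
  by move=> w; case: ifP.
rewrite -(Xe _ _ ww'); case: ifP => Xw; apply/negP.
  by apply: g1P; rewrite ww' Xw.
by apply: g2P; rewrite ww' Xw.
Qed.

(** * Pairs of end colours excluded by an ear *)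

Notation colour := 'I_4.
Implicit Types (x y z : G) (xs ys zs : seq G) (W : seq G) (e : ear G)
  (K : {set colour * colour}).

Definition proper_on (g : G -> colour) e :=
  path (fun u v => g u != g v) e.1.1 (rcons e.1.2 e.2).

Definition kills e K := exists l : G -> {set colour},
  {in inner e, forall v, #|l v| = 2} /\
  forall g : G -> colour, {in inner e, forall v, g v \in l v} ->
    proper_on g e -> (g e.1.1, g e.2) \notin K.

Lemma ear_rel_sym (es : seq (ear G)) : symmetric (ear_rel es).
Proof. by move=> u v; apply: eq_has => e; rewrite orbC. Qed.

(** The killing lists of the ears, together with [B] on [W], admit no colouring of the union of the
    ears. An edge missed by that union would make it a proper subgraph, hence 2-choosable. *)
Lemma critical_covers W (eks : seq (ear G * {set colour * colour}))
    (B : G -> {set colour}) :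
  ear_system W [seq ek.1 | ek <- eks] ->
  (forall v, #|B v| = 2) -> {in eks, forall ek, kills ek.1 ek.2} ->
  (forall g : G -> colour, {in W, forall v, g v \in B v} ->
     has (fun ek : ear G * {set colour * colour} => (g ek.1.1.1, g ek.1.2) \in ek.2) eks) ->
  covers [seq ek.1 | ek <- eks].
Proof.
set es := [seq ek.1 | ek <- eks]; move=> /andP[uW esW] B2 killed allkilled u v uv.
apply/negPn/negP => nuv.
pose Q (ek : ear G * {set colour * colour}) (l : G -> {set colour}) :=
  {in inner ek.1, forall v, #|l v| = 2} /\
  forall g : G -> colour, {in inner ek.1, forall v, g v \in l v} ->
    proper_on g ek.1 -> (g ek.1.1.1, g ek.1.2) \notin ek.2.
have esE : [seq inner e | e <- es] = [seq inner ek.1 | ek <- eks].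
  by rewrite -map_comp.
have [|||l [lQ lB]] := @glue _ _ _ B (fun ek => inner ek.1) Q eks.
- by move: uW; rewrite esE cat_uniq => /and3P[].
- move=> ek f f' ff' [f2 fg]; split; first by move=> w we; rewrite -ff' ?f2.
  by move=> g gf; apply: fg => w we; rewrite ff' ?gf.
- exact: killed.
have l2 w : #|l w| = 2.
  have [/flatten_mapP[ek ees we]|wn] := boolP (w \in flatten [seq inner ek.1 | ek <- eks]).
    by have [->] := lQ _ ees.
  by rewrite lB.
have [|g [gl gr]] := @critical_spanning (ear_rel es) u v _ l (@ear_rel_sym es) _ uv nuv l2.
  move=> w w' /hasP[e ees].
  have /and3P[_ _ /path_zip we] := allP esW _ ees.
  by case/orP=> /we //=; rewrite edge_sym.
have /allkilled/hasP[ek ees] : {in W, forall v, g v \in B v}.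
  move=> w wW; rewrite -lB ?gl //; apply/negP => win.
  by move: uW; rewrite esE cat_uniq => /and3P[_ /hasPn/(_ _ win)]; rewrite wW.
apply/negP; have [_] := lQ _ ees; apply=> [w _|]; first exact: gl.
rewrite /proper_on; have : forall w w', (w, w') \in ear_edges ek.1 -> g w != g w'.
  move=> w w' ww'; apply: gr; apply/hasP; exists ek.1; rewrite ?ww' //.
  exact: map_f.
rewrite /ear_edges; elim: (rcons _ _) (ek.1.1.1) => //= a p IHp b gE.
rewrite gE ?mem_head //= IHp // => w w' ww'.
by apply: gE; rewrite inE ww' orbT.
Qed.

(** When [x] has colour [a], the list [[set a; c]] forces [c] at the first inner vertex, and
    [(c, b)] is killed on the rest. The hypotheses exclude an edge with unequal end colours and a
    single inner vertex with equal ones. *)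
Lemma kill_pair x xs y (a b : colour) : uniq xs ->
  (size xs = 0 -> a = b) -> (size xs = 1 -> a != b) ->
  kills (x, xs, y) [set (a, b)].
Proof.
elim: xs x a => [|z xs IHxs] x a /=.
  move=> _ /(_ erefl) <- _; exists (fun=> [set: colour]); split=> // g _.
  by rewrite /proper_on /= andbT inE xpair_eqE; apply: contraNN => /andP[/eqP-> /eqP->].
move=> /andP[zxs uxs] _ s1.
have [xs0|xs0] := eqVneq xs [::].
  subst xs; have ab := s1 erefl.
  exists (fun=> [set a; b]); split=> [v _|g /(_ z (mem_head _ _)) gz].
    by rewrite cards2 ab.
  rewrite /proper_on /= andbT => /andP[xz zy]; rewrite inE xpair_eqE /=.
  apply/andP => -[/eqP ga /eqP gb]; move: gz xz zy; rewrite ga gb !inE.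
  by case/orP=> /eqP->; rewrite eqxx.
(* [c] must also differ from [b], in case just one inner vertex remains. *)
have [c ca cb] : exists2 c : colour, a != c & c != b.
  have /set0Pn[c] : ~: [set a; b] != set0.
    rewrite -cards_eq0; have := cardsC [set a; b]; rewrite card_ord cards2.
    by case: (a != b) => /=; lia.
  by rewrite !inE negb_or => /andP[? ?]; exists c; rewrite // eq_sym.
have [||l [l2 lP]] := IHxs z c uxs; rewrite ?cb //.
  by move/size0nil => E; rewrite E in xs0.
exists (fun v => if v == z then [set a; c] else l v); split=> [v|g gl].
  rewrite inE; case: eqVneq => [->|vz] /=; first by rewrite cards2 ca.
  exact: l2.
rewrite /proper_on /= => /andP[xz p]; rewrite inE xpair_eqE /=.
apply/andP => -[/eqP ga /eqP gb].
have gz : g z = c.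
  have := gl z (mem_head _ _); rewrite eqxx !inE => /orP[] /eqP // gza.
  by move: xz; rewrite ga gza eqxx.
have gxs : {in inner (z, xs, y), forall v, g v \in l v}.
  move=> v vxs; have := gl v; rewrite inE vxs orbT => /(_ isT).
  by case: eqVneq => // vz; rewrite -vz vxs in zxs.
by have := lP g gxs p; rewrite /= gz gb inE eqxx.
Qed.

(** * Subgraphs that exhaust a critical graph *)

Definition c0 : colour := inord 0.
Definition c1 : colour := inord 1.
Definition c2 : colour := inord 2.
Definition c3 : colour := inord 3.

Lemma c0_c1 : c0 != c1.
Proof. by rewrite -val_eqE /= !inordK. Qed.

Lemma c2_c3 : c2 != c3.
Proof. by rewrite -val_eqE /= !inordK. Qed.

(** The end pairs contradicting the alternation of two colours; [o] tells whether the number of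
    inner vertices is odd. *)
Definition parity_pairs (o : bool) : {set colour * colour} :=
  if o then [set (c0, c1); (c1, c0)] else [set (c0, c0); (c1, c1)].

Lemma kill_parity x xs y : kills (x, xs, y) (parity_pairs (odd (size xs))).
Proof.
exists (fun=> [set c0; c1]); split=> [v _|g].
  by rewrite cards2 c0_c1.
rewrite /inner /proper_on /=; elim: xs x => [|z xs IHxs] x gl /=.
  rewrite andbT /parity_pairs !inE !xpair_eqE /=; apply: contraNN.
  by case/orP=> /andP[/eqP-> /eqP->].
case/andP=> xz p.
have gz : g z \in [set c0; c1] by apply: gl; rewrite mem_head.
have gxs : {in xs, forall v, g v \in [set c0; c1]}.
  by move=> v vxs; apply: gl; rewrite inE vxs orbT.
apply: contraNN (IHxs z gxs p) => pxy; move: pxy gz xz; rewrite /parity_pairs.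
by case: (odd _); rewrite !inE !xpair_eqE /= => /orP[]/andP[/eqP-> /eqP->] /orP[]/eqP->;
  rewrite ?eqxx ?orbT.
Qed.

Lemma covers_two_cycles x xs ys :
  ear_system [:: x] [:: (x, xs, x); (x, ys, x)] ->
  1 < size xs -> 1 < size ys -> covers [:: (x, xs, x); (x, ys, x)].
Proof.
move=> sys xs1 ys1.
have [uxs uys] : uniq xs /\ uniq ys.
  by case/andP: (sys) => + _; rewrite /= cats0 cat_uniq => /andP[_ /and3P[]].
apply: (@critical_covers [:: x] [:: ((x, xs, x), [set (c0, c0)]); ((x, ys, x), [set (c1, c1)])]
  (fun=> [set c0; c1])) => //.
- by move=> v; rewrite cards2 c0_c1.
- by move=> ek; rewrite !inE => /orP[]/eqP->; apply: kill_pair => //=; lia.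
move=> g /(_ x (mem_head _ _)) /=; rewrite !inE !xpair_eqE.
by case/orP=> /eqP->; rewrite !eqxx ?orbT.
Qed.

(** The cycle at [x] forces [c1] there, the connecting ear then excludes [b] at [y], and the cycle
    at [y] excludes [b']. *)
Lemma covers_dumbbell x y xs ys zs :
  ear_system [:: x; y] [:: (x, xs, x); (x, zs, y); (y, ys, y)] ->
  1 < size xs -> 1 < size ys -> covers [:: (x, xs, x); (x, zs, y); (y, ys, y)].
Proof.
move=> sys xs1 ys1.
have [uxs uzs uys] : [/\ uniq xs, uniq zs & uniq ys].
  case/andP: (sys) => + _; rewrite /= cats0 !cat_uniq => /and3P[_ _ /and3P[-> _]].
  by move=> /and3P[-> _ ->].
(* By [kill_pair] an edge kills only equal pairs, and a single inner vertex only unequal ones. *)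
pose b := if size zs == 1 then c0 else c1.
pose b' := if size zs == 1 then c1 else c0.
apply: (@critical_covers [:: x; y] [:: ((x, xs, x), [set (c0, c0)]);
    ((x, zs, y), [set (c1, b)]); ((y, ys, y), [set (b', b')])]
  (fun=> [set c0; c1])) => //.
- by move=> v; rewrite cards2 c0_c1.
- move=> ek; rewrite !inE => /or3P[]/eqP->; apply: kill_pair => //=; try lia.
    by rewrite /b => ->.
  by rewrite /b => -> /=; rewrite eq_sym c0_c1.
move=> g gW; have := gW x (mem_head _ _).
have {gW} := gW y; rewrite /= !inE eqxx orbT => /(_ isT).
rewrite !xpair_eqE /b /b'; case: (size zs == 1);
by move=> /orP[]/eqP-> /orP[]/eqP->; rewrite !eqxx ?orbT.
Qed.

(** The first ear, possibly an edge, kills both equal pairs by parity; the other two kill one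
    unequal pair each. *)
Lemma covers_theta_odd x y xs ys zs :
  ear_system [:: x; y] [:: (x, xs, y); (x, ys, y); (x, zs, y)] ->
  ~~ odd (size xs) -> ~~ odd (size ys) -> ~~ odd (size zs) ->
  0 < size ys -> 0 < size zs ->
  covers [:: (x, xs, y); (x, ys, y); (x, zs, y)].
Proof.
move=> sys oxs oys ozs ys0 zs0.
have [uxs uys uzs] : [/\ uniq xs, uniq ys & uniq zs].
  case/andP: (sys) => + _; rewrite /= cats0 !cat_uniq => /and3P[_ _ /and3P[-> _]].
  by move=> /and3P[-> _ ->].
apply: (@critical_covers [:: x; y] [:: ((x, xs, y), parity_pairs (odd (size xs)));
    ((x, ys, y), [set (c0, c1)]); ((x, zs, y), [set (c1, c0)])]
  (fun=> [set c0; c1])) => //.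
- by move=> v; rewrite cards2 c0_c1.
- move=> ek; rewrite !inE => /or3P[]/eqP->; first exact: kill_parity.
    by apply: kill_pair => //=; [lia | move=> s1; rewrite s1 in oys].
  by apply: kill_pair => //=; [lia | move=> s1; rewrite s1 in ozs].
move=> g gW; have := gW x (mem_head _ _).
have {gW} := gW y; rewrite /= (negPf oxs) /parity_pairs !inE eqxx orbT => /(_ isT).
rewrite !xpair_eqE.
by move=> /orP[]/eqP-> /orP[]/eqP->; rewrite !eqxx ?orbT.
Qed.

(** The first ear kills both unequal pairs by parity; the others kill one equal pair each, hence the
    two inner vertices. *)
Lemma covers_theta_even x y xs ys zs :
  ear_system [:: x; y] [:: (x, xs, y); (x, ys, y); (x, zs, y)] ->
  odd (size xs) -> 1 < size ys -> 1 < size zs ->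
  covers [:: (x, xs, y); (x, ys, y); (x, zs, y)].
Proof.
move=> sys oxs ys1 zs1.
have [uxs uys uzs] : [/\ uniq xs, uniq ys & uniq zs].
  case/andP: (sys) => + _; rewrite /= cats0 !cat_uniq => /and3P[_ _ /and3P[-> _]].
  by move=> /and3P[-> _ ->].
apply: (@critical_covers [:: x; y] [:: ((x, xs, y), parity_pairs (odd (size xs)));
    ((x, ys, y), [set (c0, c0)]); ((x, zs, y), [set (c1, c1)])]
  (fun=> [set c0; c1])) => //.
- by move=> v; rewrite cards2 c0_c1.
- move=> ek; rewrite !inE => /or3P[]/eqP->; first exact: kill_parity.
    by apply: kill_pair => //=; lia.
  by apply: kill_pair => //=; lia.
move=> g gW; have := gW x (mem_head _ _).
have {gW} := gW y; rewrite /= oxs /parity_pairs !inE eqxx orbT => /(_ isT).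
rewrite !xpair_eqE.
by move=> /orP[]/eqP-> /orP[]/eqP->; rewrite !eqxx ?orbT.
Qed.

(** Disjoint lists at [x] and [y] leave four pairs, one for each ear. All are unequal, so one inner
    vertex per ear is enough. *)
Lemma covers_four_ears x y xs ys zs ts :
  ear_system [:: x; y] [:: (x, xs, y); (x, ys, y); (x, zs, y); (x, ts, y)] ->
  0 < size xs -> 0 < size ys -> 0 < size zs -> 0 < size ts ->
  covers [:: (x, xs, y); (x, ys, y); (x, zs, y); (x, ts, y)].
Proof.
move=> sys xs0 ys0 zs0 ts0.
have [xy uxs uys uzs uts] : [/\ x != y, uniq xs, uniq ys, uniq zs & uniq ts].
  case/andP: (sys) => + _; rewrite /= cats0 inE negb_or !cat_uniq.
  move=> /and3P[/andP[-> _] _ /and3P[-> _]].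
  by move=> /and3P[-> _ /and3P[-> _ ->]].
have ne (i j : nat) : i < 4 -> j < 4 -> i != j -> inord i != inord j :> colour.
  by move=> i4 j4 ij; rewrite -val_eqE /= !inordK.
apply: (@critical_covers [:: x; y] [:: ((x, xs, y), [set (c0, c2)]);
    ((x, ys, y), [set (c0, c3)]); ((x, zs, y), [set (c1, c2)]); ((x, ts, y), [set (c1, c3)])]
  (fun v => if v == x then [set c0; c1] else [set c2; c3])) => //.
- by move=> v; case: ifP; rewrite cards2 ?c0_c1 ?c2_c3.
- by move=> ek; rewrite !inE => /or4P[]/eqP->; apply: kill_pair => //=; try lia;
    move=> _; apply: ne.
move=> g gW; have := gW x (mem_head _ _).
have {gW} := gW y; rewrite /= !inE !eqxx orbT => /(_ isT).
rewrite [y == x]eq_sym (negPf xy) !inE !xpair_eqE.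
by move=> /orP[]/eqP-> /orP[]/eqP->; rewrite !eqxx ?orbT.
Qed.

End Critical.

(** * Structure of critical graphs *)

Arguments walk : simpl never.

(** Reduces the disjointness of rearranged ears to linear arithmetic on counts. *)
Lemma uniq_count (T : eqType) (s t : seq T) :
  (forall P : pred T, count P s <= count P t) -> uniq t -> uniq s.
Proof.
move=> st; have countP (r : seq T) : uniq r <-> forall x, count_mem x r <= 1.
  split=> [ur x|r1]; first by rewrite count_uniq_mem //; case: (_ \in _).
  elim: r r1 => //= x r IHr r1; rewrite IHr ?andbT; last first.
    by move=> y; have := r1 y; case: (x == y) => /=; lia.
  by have := r1 x; rewrite eqxx add1n ltnS leqn0 => /eqP/count_memPn.
by move=> /countP ut; apply/countP => x; apply: leq_trans (st _) (ut x).
Qed.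

Lemma mem_zip (S T : eqType) (s : seq S) (t : seq T) u v :
  (u, v) \in zip s t -> u \in s /\ v \in t.
Proof.
elim: s t => [|x s IHs] [|y t] //=; rewrite !inE xpair_eqE.
by case/orP=> [/andP[/eqP-> /eqP->]|/IHs[-> ->]]; rewrite ?eqxx ?orbT.
Qed.

Ltac count_lia :=
  rewrite /inner /= -?cats1; do 5!rewrite ?(cats0, count_cat, count_rev) /=;
  repeat match goal with
    | |- context [count ?P ?s] => move: (count P s) => ?
    | |- context [nat_of_bool ?b] => move: (nat_of_bool b) => ?
  end; clear; lia.

Ltac by_count U := apply: uniq_count U; let P := fresh "P" in move=> P; count_lia.

Section WalkTheory.

Variable G : sgraph.
Implicit Types (x y z : G) (xs ys : seq G) (W : seq G) (es : seq (ear G)).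

Lemma walk_nil x y : walk x [::] y = edge x y.
Proof. by rewrite /walk /= andbT. Qed.

Lemma walk_cons x z xs y : walk x (z :: xs) y = edge x z && walk z xs y.
Proof. by []. Qed.

Lemma walk_rev x xs y : walk x xs y -> walk y (rev xs) x.
Proof.
elim: xs x => [|z xs IHxs] x; first by rewrite /rev /= !walk_nil edge_sym.
rewrite walk_cons => /andP[xz /IHxs]; rewrite rev_cons -cats1 walk_cat => ->.
by rewrite walk_nil edge_sym.
Qed.

Lemma ear_edges_cat x xs y ys z :
  ear_edges (x, xs ++ y :: ys, z) = ear_edges (x, xs, y) ++ ear_edges (y, ys, z).
Proof. by rewrite /ear_edges /=; elim: xs x => [|w xs IHxs] x //=; rewrite IHxs. Qed.

Lemma ear_rel_vertex W es u v :
  ear_system W es -> ear_rel es u v -> u \in W ++ flatten [seq inner e | e <- es].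
Proof.
case/andP=> _ esW /hasP[[[x xs] y] ees].
have /and3P[/= xW yW _] := allP esW _ ees.
have sub w : w \in x :: rcons xs y -> w \in W ++ flatten [seq inner e | e <- es].
  rewrite mem_cat inE mem_rcons inE => /or3P[/eqP->|/eqP->|wxs]; rewrite ?xW ?yW //.
  by apply/orP; right; apply/flatten_mapP; exists (x, xs, y).
by rewrite /ear_edges /= => /orP[]/mem_zip[ui vi]; apply: sub; rewrite // inE vi orbT.
Qed.

End WalkTheory.

Section Structure.

Variable G : sgraph.
Hypothesis critG : three_choosable_critical G.
Variable c : G -> bool.
Hypothesis cP : forall u v : G, edge u v -> c u != c v.
Implicit Types (x y z u v a b s t q : G) (xs ys zs Q p : seq G).

(** By [critical_degree] the walk can go on without turning back, so by finiteness it meets [X]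
    again (an ear, possibly closed) or itself (a cycle with a tail). Not turning back gives the size
    bounds; the clause on [xs = [::]] remembers the edge [sz]. *)
Lemma walk_extension (X : pred G) s z : X s -> edge s z ->
  (exists xs t, [/\ X t, walk s xs t, uniq xs, ~~ has X xs &
     (xs = [::] -> t = z) /\ (t = s -> 1 < size xs)]) \/
  (exists xs y ys, [/\ walk s xs y, walk y ys y, uniq (y :: xs ++ ys),
     ~~ has X (y :: xs ++ ys) & 1 < size ys]).
Proof.
move=> Xs sz; have [Xz|nXz] := boolP (X z).
  left; exists [::], z; rewrite walk_nil; split=> //; split=> // zs.
  by rewrite zs edge_irrefl in sz.
set concl := (_ \/ _).
suff ext p w : ~~ has X (rcons p w) -> uniq (rcons p w) -> walk s p w -> concl.
  by apply: (ext [::] z); rewrite ?walk_nil //= orbF.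
have [n] := ubnP (#|G| - size p); elim: n p w => // n IHn p w pn nX up pw.
have pG : size p < #|G|.
  by have := max_card (mem (rcons p w)); rewrite (card_uniqP up) size_rcons.
have ew : edge w (last s p).
  by move: pw; rewrite /walk rcons_path edge_sym => /andP[].
have [v wv vp] := critical_degree critG ew.
have pwv : walk s (rcons p w) v by rewrite -cats1 walk_cat pw walk_nil.
have [Xv|nXv] := boolP (X v).
  left; exists (rcons p w), v; split=> //; split=> [|vs]; first by case: (p).
  rewrite size_rcons ltnS; case: (p) vp => //=.
  by rewrite vs eqxx.
have [vpw|vpw] := boolP (v \in rcons p w); last first.
  apply: (IHn (rcons p w) v) => //.
  - by move: pn pG; rewrite size_rcons; move: #|G| (size p) => i j; clear; lia.
  - by rewrite has_rcons negb_or nXv.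
  - by rewrite rcons_uniq vpw.
right; move: vpw; rewrite mem_rcons inE => /orP[/eqP vw|vin].
  by rewrite vw edge_irrefl in wv.
case/splitPr: vin pw vp nX up {pwv pG ew IHn pn} => p1 p2.
rewrite walk_cat => /andP[w1 w2] vp nX up.
exists p1, v, (rcons p2 w); split=> //.
- by rewrite -cats1 walk_cat w2 walk_nil.
- by_count up.
- move: nX; rewrite rcons_cat /= !has_cat /= ?has_cat !negb_or.
  by case/andP=> -> /andP[-> ->].
case/lastP: p2 vp {w2 nX up} => [|p2 v']; last by rewrite !size_rcons.
by rewrite last_cat /= eqxx.
Qed.

(** By connectivity, a path from [x] to any uncovered edge either reaches it inside the ear system
    or leaves the system along an uncovered edge. *)
Lemma uncovered_edge W (es : seq (ear G)) x : ear_system W es ->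
  x \in W -> (exists x', edge x x') -> ~ covers es ->
  exists s z, [/\ s \in W ++ flatten [seq inner e | e <- es], edge s z &
    ~~ ear_rel es s z].
Proof.
move=> sys xW [x' xx'] ncov; set X := W ++ _.
have [a [b [ab nab]]] : exists a b : G, edge a b /\ ~~ ear_rel es a b.
  apply: NNPP => H; apply: ncov => a b ab; apply/negPn/negP => nab.
  by apply: H; exists a, b.
have xX : x \in X by rewrite mem_cat xW.
have [aX|naX] := boolP (a \in X); first by exists a, b.
have /connectP[p] := critical_connected critG xx' ab.
elim: p x xX {xW xx'} => [|z p IHp] x xX /=.
  by move=> _ ax; rewrite ax xX in naX.
case/andP=> xz zp alast; have [zX|nzX] := boolP (z \in X); first exact: IHp zp alast.
exists x, z; split=> //; apply: contraNN nzX; rewrite ear_rel_sym => /(ear_rel_vertex sys).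
by [].
Qed.

Definition few_ears := exists W (es : seq (ear G)),
  [/\ size W <= 2, size es <= 4, ear_system W es & covers es].

Lemma odd_of_side x xs y : walk x xs y -> odd (size xs) = (c x == c y).
Proof. by move=> /(walk_color cP)->; case: (c x); case: odd. Qed.

(* The theta graph with two ears of length 2, the only bipartite one that is
   2-choosable. *)
Definition short_theta u v a b Q :=
  [/\ [/\ edge u a, edge a v, edge u b & edge b v], walk u Q v & odd (size Q)].

Lemma short_theta_swap u v a b Q : short_theta u v a b Q -> short_theta u v b a Q.
Proof. by case=> -[]. Qed.

Lemma short_theta_flip u v a b Q : short_theta u v a b Q -> short_theta v u a b (rev Q).
Proof.
case=> -[? ? ? ?] /walk_rev w o; split=> //; last by rewrite size_rev.
by rewrite ![edge v _]edge_sym ![edge _ u]edge_sym.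
Qed.

(** * Adding an ear to a short theta graph *)

Ltac walks := rewrite /= ?inE ?eqxx ?orbT ?walk_cat ?walk_cons ?walk_nil /=;
  repeat (apply/andP; split); rewrite // edge_sym //.

(** Four ears join [u] and [v]; by parity the new one has an inner vertex. *)
Lemma theta_ear_uv u v a b Q xs : short_theta u v a b Q -> walk u xs v ->
  uniq ([:: u; v; a; b] ++ Q ++ xs) -> few_ears.
Proof.
case=> -[ua av ub bv] uQv oQ uxsv U.
have sys : ear_system [:: u; v] [:: (u, [:: a], v); (u, [:: b], v); (u, Q, v); (u, xs, v)].
  by apply/andP; split; [by_count U | walks].
exists [:: u; v], [:: (u, [:: a], v); (u, [:: b], v); (u, Q, v); (u, xs, v)].
split=> //; apply: covers_four_ears => //; first by case: (Q) oQ.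
have := odd_of_side uxsv; rewrite -(odd_of_side uQv) oQ.
by case: (xs).
Qed.

(** The 4-cycle and the cycle closed by the new ear share only [u]. *)
Lemma theta_ear_uq u v a b Q1 q Q2 xs : short_theta u v a b (Q1 ++ q :: Q2) ->
  walk u xs q -> uniq ([:: u; v; a; b] ++ (Q1 ++ q :: Q2) ++ xs) ->
  0 < size Q1 + size xs -> few_ears.
Proof.
case=> -[ua av ub bv]; rewrite walk_cat => /andP[w1 w2] oQ uxsq U Q10.
have sys : ear_system [:: u] [:: (u, [:: a; v; b], u); (u, Q1 ++ q :: rev xs, u)].
  by apply/andP; split; [by_count U | have w3 := walk_rev uxsq; walks].
exists [:: u], [:: (u, [:: a; v; b], u); (u, Q1 ++ q :: rev xs, u)].
by split=> //; apply: covers_two_cycles => //; rewrite size_cat /= size_rev addnS ltnS -?lt0n.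
Qed.

(** A dumbbell: the 4-cycle, the segment [Q1], and the cycle formed by [Q2] and the new ear. *)
Lemma theta_ear_qq u v a b Q1 q Q2 q' Q3 xs :
  short_theta u v a b (Q1 ++ q :: Q2 ++ q' :: Q3) -> walk q xs q' ->
  uniq ([:: u; v; a; b] ++ (Q1 ++ q :: Q2 ++ q' :: Q3) ++ xs) ->
  0 < size Q2 + size xs -> few_ears.
Proof.
case=> -[ua av ub bv]; rewrite !walk_cat => /and3P[w1 w2 w3] oQ qxsq U Q20.
have sys : ear_system [:: u; q]
    [:: (u, [:: a; v; b], u); (u, Q1, q); (q, Q2 ++ q' :: rev xs, q)].
  by apply/andP; split; [by_count U | have w4 := walk_rev qxsq; walks].
exists [:: u; q], [:: (u, [:: a; v; b], u); (u, Q1, q); (q, Q2 ++ q' :: rev xs, q)].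
by split=> //; apply: covers_dumbbell => //; rewrite size_cat /= size_rev addnS ltnS -?lt0n.
Qed.

(** Three ears join the adjacent vertices [a] and [v]: their edge, the new ear continued through
    [b], and the way through [u] and [Q]. *)
Lemma theta_ear_ab u v a b Q xs : short_theta u v a b Q -> walk a xs b ->
  uniq ([:: u; v; a; b] ++ Q ++ xs) -> few_ears.
Proof.
case=> -[ua av ub bv] uQv oQ axsb U.
have w1 : walk a (xs ++ [:: b]) v by walks.
have w2 : walk a (u :: Q) v by walks.
have sys : ear_system [:: a; v] [:: (a, [::], v); (a, xs ++ [:: b], v); (a, u :: Q, v)].
  by apply/andP; split; [by_count U | walks].
exists [:: a; v], [:: (a, [::], v); (a, xs ++ [:: b], v); (a, u :: Q, v)].
split=> //; apply: covers_theta_odd => //; last by rewrite size_cat addn1.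
  by rewrite (odd_of_side w1) cP.
by rewrite (odd_of_side w2) cP.
Qed.

Lemma theta_ear_au u v a b Q xs : short_theta u v a b Q -> walk a xs u ->
  uniq ([:: u; v; a; b] ++ Q ++ xs) -> 0 < size xs -> few_ears.
Proof.
case=> -[ua av ub bv] uQv oQ axsu U xs0.
have sys : ear_system [:: a; u] [:: (a, [::], u); (a, xs, u); (a, [:: v; b], u)].
  by apply/andP; split; [by_count U | walks].
exists [:: a; u], [:: (a, [::], u); (a, xs, u); (a, [:: v; b], u)].
split=> //; apply: covers_theta_odd => //.
by rewrite (odd_of_side axsu) eq_sym cP.
Qed.

(* One of [c a <> c q] and [c v <> c q] holds, which gives two vertices on
   opposite sides joined by three ears. *)
Lemma theta_ear_aq u v a b Q1 q Q2 xs : short_theta u v a b (Q1 ++ q :: Q2) ->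
  walk a xs q -> uniq ([:: u; v; a; b] ++ (Q1 ++ q :: Q2) ++ xs) -> few_ears.
Proof.
case=> -[ua av ub bv]; rewrite walk_cat => /andP[w1 w2] oQ axsq U.
have w2r := walk_rev w2; have [caq|caq] := eqVneq (c a) (c q).
  have cvq : (c v == c q) = false by rewrite -caq eq_sym; exact: negbTE (cP av).
  have w3 : walk v (a :: xs) q by walks.
  have w4 : walk v [:: b, u & Q1] q by walks.
  have sys : ear_system [:: v; q]
      [:: (v, rev Q2, q); (v, a :: xs, q); (v, [:: b, u & Q1], q)].
    by apply/andP; split; [by_count U | walks].
  exists [:: v; q], [:: (v, rev Q2, q); (v, a :: xs, q); (v, [:: b, u & Q1], q)].
  split=> //; apply: covers_theta_odd => //.
  - by rewrite (odd_of_side w2r) cvq.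
  - by rewrite (odd_of_side w3) cvq.
  - by rewrite (odd_of_side w4) cvq.
have w3 : walk a (u :: Q1) q by walks.
have w4 : walk a (v :: rev Q2) q by walks.
have sys : ear_system [:: a; q]
    [:: (a, xs, q); (a, u :: Q1, q); (a, v :: rev Q2, q)].
  by apply/andP; split; [by_count U | walks].
exists [:: a; q], [:: (a, xs, q); (a, u :: Q1, q); (a, v :: rev Q2, q)].
split=> //; apply: covers_theta_odd => //.
- by rewrite (odd_of_side axsq).
- by rewrite (odd_of_side w3).
- by rewrite (odd_of_side w4).
Qed.

(** The 4-cycle serves [u], [v], [a], [b], and the cycle of [Q] with [a] serves the rest. The counts
    say that it repeats no vertex and stays in the theta graph. *)
Lemma cycle_through u v a b Q s : short_theta u v a b Q ->
  s \in [:: u; v; a; b] ++ Q ->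
  exists ys, [/\ walk s ys s, 1 < size ys &
    forall P : pred G, count P (s :: ys) <= count P ([:: u; v; a; b] ++ Q)].
Proof.
case=> -[ua av ub bv] uQv oQ; rewrite mem_cat !inE -!orbA.
case/or4P=> [/eqP->|/eqP->|/eqP->|/orP[/eqP->|]].
- by exists [:: a; v; b]; split=> // [|P]; [walks | count_lia].
- by exists [:: a; u; b]; split=> // [|P]; [walks | count_lia].
- by exists [:: u; b; v]; split=> // [|P]; [walks | count_lia].
- by exists [:: u; a; v]; split=> // [|P]; [walks | count_lia].
move=> sQ; case/splitPr: sQ uQv {oQ} => Q1 Q2; rewrite walk_cat => /andP[w1 w2].
exists (Q2 ++ [:: v, a, u & Q1]); split; first by walks.
  by rewrite size_cat /= !addnS.
by move=> P; count_lia.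
Qed.

Definition theta_ears u v a b Q : seq (ear G) :=
  [:: (u, [:: a], v); (u, [:: b], v); (u, Q, v)].

Lemma ear_edges_rev x xs y s t :
  ((s, t) \in ear_edges (y, rev xs, x)) = ((t, s) \in ear_edges (x, xs, y)).
Proof.
elim: xs x => [|z xs IHxs] x; first by rewrite /ear_edges /= !inE !xpair_eqE andbC.
rewrite rev_cons -cats1 ear_edges_cat mem_cat IHxs -[z :: xs]cat0s ear_edges_cat.
by rewrite mem_cat /ear_edges /= !inE !xpair_eqE orbC [(s == z) && _]andbC.
Qed.

Lemma theta_ears_swap u v a b Q : ear_rel (theta_ears u v b a Q) =2 ear_rel (theta_ears u v a b Q).
Proof. by move=> s t; rewrite /ear_rel /= orbCA. Qed.

Lemma theta_ears_flip u v a b Q :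
  ear_rel (theta_ears v u a b (rev Q)) =2 ear_rel (theta_ears u v a b Q).
Proof.
move=> s t; rewrite /ear_rel /= -[[:: a]]/(rev [:: a]) -[[:: b]]/(rev [:: b]).
by rewrite !ear_edges_rev; congr (_ || (_ || (_ || _))); rewrite orbC.
Qed.

Lemma ear_rel_consecutive es x xs y l s t r : (x, xs, y) \in es ->
  x :: rcons xs y = l ++ [:: s, t & r] -> ear_rel es s t.
Proof.
move=> ees E; apply/hasP; exists (x, xs, y) => //; apply/orP; left.
rewrite /ear_edges /= E -[rcons xs y]/(behead (x :: rcons xs y)) E {E ees}.
case: l => [|w l] /=; first by rewrite mem_head.
elim: l w => [|w' l IHl] w /=; first by rewrite !inE eqxx orbT.
by rewrite inE IHl orbT.
Qed.

Section EarCases.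

Variables (u v a b : G) (Q : seq G).
Hypothesis th : short_theta u v a b Q.

(** The last clause keeps an ear without inner vertices from being an edge of the theta graph. *)
Definition new_ear s xs t := [/\ walk s xs t, uniq ([:: u; v; a; b] ++ Q ++ xs) &
  xs = [::] -> ~~ ear_rel (theta_ears u v a b Q) s t].

Lemma new_ear_rev s xs t : new_ear s xs t -> new_ear t (rev xs) s.
Proof.
case=> w U N; split; [exact: walk_rev | by_count U |].
by case: xs N {w U} => [N _|x xs _]; rewrite 1?ear_rel_sym ?N // => /(congr1 size); rewrite size_rev.
Qed.

Lemma new_ear_a xs t : new_ear a xs t -> t \in [:: u; v; b] ++ Q -> few_ears.
Proof.
case=> w U N; rewrite mem_cat !inE -!orbA.
have xs0 x : ear_rel (theta_ears u v a b Q) a x -> t = x -> 0 < size xs.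
  by move=> + tx; rewrite -tx; case: (xs) N => // /(_ erefl)/negPf->.
case/or4P=> [/eqP tE|/eqP tE|/eqP tE|].
- rewrite {t}tE in w N xs0 *; apply: theta_ear_au th w U _.
  apply: (xs0 u) => //; rewrite ear_rel_sym.
  by apply: (@ear_rel_consecutive _ u [:: a] v [::]); rewrite ?mem_head.
- apply: (@theta_ear_au v u a b (rev Q) xs); last 1 first.
  + apply: (xs0 v) => //.
    by apply: (@ear_rel_consecutive _ u [:: a] v [:: u] _ _ [::]); rewrite ?mem_head.
  + exact: short_theta_flip.
  + by rewrite -tE.
  + by_count U.
- by rewrite tE in w; apply: theta_ear_ab th w U.
move=> tQ; case/splitPr: tQ (th) U => Q1 Q2 th' U.
exact: theta_ear_aq th' w U.
Qed.

Lemma new_ear_u xs t : new_ear u xs t -> t \in v :: Q -> few_ears.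
Proof.
case=> w U N; rewrite !inE => /orP[/eqP tv|].
  by rewrite tv in w; apply: theta_ear_uv th w U.
move=> tQ; case/splitPr: tQ (th) U N => Q1 Q2 th' U N.
(* If [Q1] and [xs] were both empty, the new ear would be the edge from [u] to the start of [Q]. *)
apply: theta_ear_uq th' w U _; rewrite -size_cat lt0n size_eq0.
apply/eqP; case: Q1 N => // N xs0; have := N xs0.
rewrite (@ear_rel_consecutive _ u (t :: Q2) v [::] _ _ (rcons Q2 v)) //.
by rewrite !inE eqxx !orbT.
Qed.

Lemma new_ear_q xs s t : new_ear s xs t -> s \in Q -> t \in Q -> s != t -> few_ears.
Proof.
(* The order where [s] precedes [t] on [Q] is enough; reversing the ear gives the other. *)
have half Q1 s' Q2 t' xs' : new_ear s' xs' t' -> Q = Q1 ++ s' :: Q2 -> t' \in Q2 -> few_ears.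
  case=> w U N QE t'Q2; case/splitPr: t'Q2 QE => Q3 Q4 QE.
  move: (th) U N; rewrite QE => th' U N; apply: theta_ear_qq th' w U _.
  rewrite -size_cat lt0n size_eq0; apply/eqP.
  case: Q3 QE N => // QE N xs0; have := N xs0.
  rewrite (@ear_rel_consecutive _ u (Q1 ++ [:: s', t' & Q4]) v (u :: Q1) _ _ (rcons Q4 v)) //.
    by rewrite !inE eqxx !orbT.
  by rewrite rcons_cat.
move=> new sQ tQ st.
have [Q1 [Q2 QE]] : exists Q1 Q2, Q = Q1 ++ s :: Q2.
  by case/splitPr: sQ => Q1 Q2; exists Q1, Q2.
move: tQ; rewrite QE mem_cat inE eq_sym (negPf st) /= => /orP[tQ1|]; last exact: half new QE.
case/splitPr: tQ1 QE => Q3 Q4; rewrite -catA /= => QE.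
by apply: half (new_ear_rev new) QE _; rewrite mem_cat mem_head orbT.
Qed.

End EarCases.

Lemma new_ear_swap u v a b Q s xs t :
  new_ear u v a b Q s xs t -> new_ear u v b a Q s xs t.
Proof. by case=> w U N; split=> //; [by_count U | rewrite theta_ears_swap]. Qed.

Lemma new_ear_flip u v a b Q s xs t :
  new_ear u v a b Q s xs t -> new_ear v u a b (rev Q) s xs t.
Proof. by case=> w U N; split=> //; [by_count U | rewrite theta_ears_flip]. Qed.

(** Reversing the ear and exchanging [a] with [b] or [u] with [v] leaves three cases: a start at
    [a], a start at [u], or both ends on [Q]. *)
Lemma new_ear_few u v a b Q s xs t : short_theta u v a b Q ->
  new_ear u v a b Q s xs t -> s \in [:: u; v; a; b] ++ Q ->
  t \in [:: u; v; a; b] ++ Q -> s != t -> few_ears.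
Proof.
move=> th new sX tX st.
have from_a xs' t' : new_ear u v a b Q a xs' t' -> t' \in [:: u; v; a; b] ++ Q ->
    a != t' -> few_ears.
  move=> new' t'X at'; apply: (new_ear_a th new').
  by move: t'X; rewrite !mem_cat !inE -!orbA [t' == a]eq_sym (negPf at').
have from_b xs' t' : new_ear u v a b Q b xs' t' -> t' \in [:: u; v; a; b] ++ Q ->
    b != t' -> few_ears.
  move=> /new_ear_swap new' t'X bt'; apply: (new_ear_a (short_theta_swap th) new').
  by move: t'X; rewrite !mem_cat !inE -!orbA [t' == b]eq_sym (negPf bt').
have [sa|sa] := eqVneq s a; first by rewrite sa in new st; apply: from_a new tX st.
have [sb|sb] := eqVneq s b; first by rewrite sb in new st; apply: from_b new tX st.
have [ta|ta] := eqVneq t a.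
  by rewrite ta in new st; apply: from_a (new_ear_rev new) sX _; rewrite eq_sym.
have [tb|tb] := eqVneq t b.
  by rewrite tb in new st; apply: from_b (new_ear_rev new) sX _; rewrite eq_sym.
have from_u xs' t' : new_ear u v a b Q u xs' t' -> t' \in [:: u; v] ++ Q ->
    u != t' -> few_ears.
  move=> new' t'X ut'; apply: (new_ear_u th new').
  by move: t'X; rewrite mem_cat !inE [t' == u]eq_sym (negPf ut').
have from_v xs' t' : new_ear u v a b Q v xs' t' -> t' \in [:: u; v] ++ Q ->
    v != t' -> few_ears.
  move=> /new_ear_flip new' t'X vt'; apply: (new_ear_u (short_theta_flip th) new').
  by move: t'X; rewrite mem_cat !inE mem_rev [t' == v]eq_sym (negPf vt') orbF.
move: sX tX; rewrite !mem_cat !inE (negPf sa) (negPf sb) (negPf ta) (negPf tb) !orbF => sX tX.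
have [su|su] := eqVneq s u.
  by rewrite su in new st; apply: from_u new _ st; rewrite mem_cat !inE.
have [sv|sv] := eqVneq s v.
  by rewrite sv in new st; apply: from_v new _ st; rewrite mem_cat !inE.
have [tu|tu] := eqVneq t u.
  rewrite tu in new st; apply: from_u (new_ear_rev new) _ _; last by rewrite eq_sym.
  by rewrite mem_cat !inE.
have [tv|tv] := eqVneq t v.
  rewrite tv in new st; apply: from_v (new_ear_rev new) _ _; last by rewrite eq_sym.
  by rewrite mem_cat !inE.
rewrite (negPf su) (negPf sv) in sX; rewrite (negPf tu) (negPf tv) in tX.
exact: (new_ear_q th new sX tX st).
Qed.

(** An uncovered edge at [s] extends to an ear or to a cycle with a tail. A closed ear or a tailed
    cycle is paired with a cycle of the theta graph through [s]. *)
Lemma short_theta_few u v a b Q : short_theta u v a b Q ->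
  uniq ([:: u; v; a; b] ++ Q) -> few_ears.
Proof.
move=> th U; have [[ua av ub bv] uQv oQ] := th.
have sys : ear_system [:: u; v] (theta_ears u v a b Q).
  by apply/andP; split; [by_count U | walks].
have [cov|ncov] := classic (covers (theta_ears u v a b Q)).
  by exists [:: u; v], (theta_ears u v a b Q).
have [||s [z [sX sz nsz]]] := @uncovered_edge _ _ u sys _ _ ncov.
- by rewrite mem_head.
- by exists a.
rewrite /= cats0 -/([:: u; v; a; b] ++ Q) in sX.
have [ys [sys_s ys1 ysX]] := cycle_through th sX.
pose X := mem ([:: u; v; a; b] ++ Q).
have disjX xs : uniq xs -> ~~ has X xs -> uniq ([:: u; v; a; b] ++ Q ++ xs).
  by move=> uxs nX; rewrite catA cat_uniq U nX.
have [[xs [t [tX w uxs nX [xs0 ts]]]]|[xs [y [zs [w1 w2 uxs nX zs1]]]]] :=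
  @walk_extension X s z sX sz.
  have [st|st] := eqVneq s t.
    have Uxs : uniq (s :: ys ++ xs).
      apply: uniq_count (disjX xs uxs nX) => P.
      by have := ysX P; count_lia.
    rewrite -st in w ts.
    exists [:: s], [:: (s, ys, s); (s, xs, s)].
    have sys' : ear_system [:: s] [:: (s, ys, s); (s, xs, s)].
      by apply/andP; split; [by_count Uxs | walks].
    by split=> //; apply: covers_two_cycles => //; apply: ts.
  apply: (@new_ear_few _ _ _ _ _ _ xs _ th _ sX tX st); split=> //; first exact: disjX.
  by move=> /xs0->.
have Uxs : uniq (s :: ys ++ y :: xs ++ zs).
  apply: uniq_count (disjX _ uxs nX) => P.
  by have := ysX P; count_lia.
exists [:: s; y], [:: (s, ys, s); (s, xs, y); (y, zs, y)].
have sys' : ear_system [:: s; y] [:: (s, ys, s); (s, xs, y); (y, zs, y)].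
  by apply/andP; split; [by_count Uxs | walks].
by split=> //; apply: covers_dumbbell.
Qed.

(** * From a cycle to few ears *)

Lemma ear_system_perm W (es es' : seq (ear G)) :
  perm_eq es es' -> ear_system W es = ear_system W es'.
Proof.
move=> pe; rewrite /ear_system (perm_all _ pe); congr (_ && _); apply: perm_uniq.
by rewrite perm_cat2l perm_flatten // perm_map.
Qed.

(** At most one ear is an edge. If the ends are in opposite classes, [covers_theta_odd] applies.
    Otherwise all ears are odd, and either two are long enough for [covers_theta_even] or two have
    one inner vertex, which gives a short theta graph. *)
Lemma theta_few x y xs ys zs :
  ear_system [:: x; y] [:: (x, xs, y); (x, ys, y); (x, zs, y)] ->
  1 < (0 < size xs) + (0 < size ys) + (0 < size zs) -> few_ears.
Proof.
move=> sys two.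
have [wx wy wz] : [/\ walk x xs y, walk x ys y & walk x zs y].
  by case/andP: (sys) => _ /=; rewrite !inE !eqxx orbT /= andbT => /and3P[].
have [[ox oy] oz] := (odd_of_side wx, odd_of_side wy, odd_of_side wz).
have rot p1 p2 p3 : ear_system [:: x; y] [:: (x, p1, y); (x, p2, y); (x, p3, y)] ->
    ear_system [:: x; y] [:: (x, p3, y); (x, p1, y); (x, p2, y)].
  rewrite (@ear_system_perm _ _ [:: (x, p3, y); (x, p1, y); (x, p2, y)]) //.
  by rewrite perm_sym -(perm_rot 1); apply: perm_refl.
have odd_theta p1 p2 p3 :
    ear_system [:: x; y] [:: (x, p1, y); (x, p2, y); (x, p3, y)] ->
    ~~ odd (size p1) -> ~~ odd (size p2) -> ~~ odd (size p3) ->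
    0 < size p2 -> 0 < size p3 -> few_ears.
  by move=> sys' ? ? ? ? ?; exists [:: x; y], [:: (x, p1, y); (x, p2, y); (x, p3, y)];
    split=> //; apply: covers_theta_odd.
have even_theta p1 p2 p3 :
    ear_system [:: x; y] [:: (x, p1, y); (x, p2, y); (x, p3, y)] ->
    odd (size p1) -> 1 < size p2 -> 1 < size p3 -> few_ears.
  by move=> sys' ? ? ?; exists [:: x; y], [:: (x, p1, y); (x, p2, y); (x, p3, y)];
    split=> //; apply: covers_theta_even.
have short p1 p2 p3 :
    ear_system [:: x; y] [:: (x, p1, y); (x, p2, y); (x, p3, y)] ->
    size p1 = 1 -> size p2 = 1 -> odd (size p3) -> few_ears.
  case: p1 => [|a []] //; case: p2 => [|b []] // /andP[U].
  rewrite /= !inE !eqxx orbT /= !walk_cons !walk_nil andbT.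
  case/and3P=> /andP[xa ay] /andP[xb by_] w3 _ _ o3.
  by apply: (@short_theta_few x y a b p3) => //; by_count U.
have [sys2 sys3] := (rot _ _ _ sys, rot _ _ _ (rot _ _ _ sys)).
have [cxy|cxy] := boolP (c x == c y); rewrite ?cxy ?(negPf cxy) in ox oy oz.
  have pos p : odd (size p) -> (1 < size p) || (size p == 1).
    by case: (size p) => [|[]].
  have [/orP[x1|/eqP x1] /orP[y1|/eqP y1] /orP[z1|/eqP z1]] :=
    And3 (pos xs ox) (pos ys oy) (pos zs oz).
  - exact: even_theta sys ox y1 z1.
  - exact: even_theta sys2 oz x1 y1.
  - exact: even_theta sys3 oy z1 x1.
  - exact: short sys3 y1 z1 ox.
  - exact: even_theta sys ox y1 z1.
  - exact: short sys2 z1 x1 oy.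
  - exact: short sys x1 y1 oz.
  - exact: short sys x1 y1 oz.
have [x0|x0] := posnP (size xs).
  by apply: odd_theta sys _ _ _ _ _; rewrite ?ox ?oy ?oz //; move: two; rewrite x0;
    case: (size ys) (size zs) => [|?] [|?].
have [y0|y0] := posnP (size ys).
  by apply: odd_theta sys3 _ _ _ _ _; rewrite ?ox ?oy ?oz //; move: two; rewrite y0 x0;
    case: (size zs).
by apply: odd_theta sys2 _ _ _ _ _; rewrite ?ox ?oy ?oz.
Qed.

(** Moves the base point of a cycle to the vertex where an uncovered edge starts. *)
Lemma rotate_cycle x xs s : ear_system [:: x] [:: (x, xs, x)] -> s \in x :: xs ->
  exists ys, [/\ ear_system [:: s] [:: (s, ys, s)], size ys = size xs,
    s :: ys =i x :: xs &
    ear_rel [:: (s, ys, s)] =2 ear_rel [:: (x, xs, x)]].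
Proof.
move=> sys; rewrite inE => /orP[/eqP->|sxs]; first by exists xs.
case/splitPr: sxs sys => p1 p2 /andP[U]; rewrite /= !inE !eqxx walk_cat !andbT => /and4P[_ _ w1 w2].
exists (p2 ++ x :: p1); split.
- by apply/andP; split; [by_count U | walks].
- by rewrite !size_cat /= !addnS addnC.
- by move=> w; rewrite !(inE, mem_cat); do !bool_congr.
by move=> w w'; rewrite /ear_rel /= !ear_edges_cat !mem_cat !orbF orbACA [RHS]orbACA
  [RHS]orbC.
Qed.

(** If the cycle misses an edge, walking on yields a dumbbell, two cycles sharing [s], or an ear
    forming a theta graph with two arcs of the cycle. *)
Lemma cycle_few x xs : ear_system [:: x] [:: (x, xs, x)] -> 1 < size xs -> few_ears.
Proof.
move=> sys0 xs1; have [cov|ncov] := classic (covers [:: (x, xs, x)]).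
  by exists [:: x], [:: (x, xs, x)].
have [||s [z [sX sz]]] := @uncovered_edge _ _ x sys0 _ _ ncov.
- exact: mem_head.
- case/andP: (sys0) => _ /=; case: (xs) xs1 => //= y ys _.
  by rewrite !inE !eqxx walk_cons /= andbT => /andP[xy _]; exists y.
rewrite /= cats0 in sX.
have [ys [sys ysxs ysX <-]] := rotate_cycle sys0 sX; rewrite -{}ysxs in xs1 => nsz.
have [Us ws] : uniq (s :: ys) /\ walk s ys s.
  case/andP: sys => U ww; split; first by_count U.
  by move: ww; rewrite /= !inE !eqxx /= andbT.
pose X := mem (s :: ys).
have disjX ts : uniq ts -> ~~ has X ts -> uniq (s :: ys ++ ts).
  by move=> uts nX; rewrite -cat_cons cat_uniq Us nX.
have [[ts [t [tX w uts nX [ts0 ts1]]]]|[ts [y [zs [w1 w2 uts nX zs1]]]]] :=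
  @walk_extension X s z (mem_head _ _) sz; last first.
  have U := disjX _ uts nX.
  exists [:: s; y], [:: (s, ys, s); (s, ts, y); (y, zs, y)].
  have sys' : ear_system [:: s; y] [:: (s, ys, s); (s, ts, y); (y, zs, y)].
    by apply/andP; split; [by_count U | walks].
  by split=> //; apply: covers_dumbbell.
have U := disjX _ uts nX.
have [ste|st] := eqVneq t s.
  rewrite ste in w ts1; exists [:: s], [:: (s, ys, s); (s, ts, s)].
  have sys' : ear_system [:: s] [:: (s, ys, s); (s, ts, s)].
    by apply/andP; split; [by_count U | walks].
  by split=> //; apply: covers_two_cycles => //; apply: ts1.
move: tX; rewrite /X /= inE (negPf st) /= => tys.
case/splitPr: tys ws U nsz xs1 {Us disjX nX ysX sys} => y1 y2.
rewrite walk_cat => /andP[w1 w2] U nsz ys1; have w3 := walk_rev w2.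
apply: (@theta_few s t y1 (rev y2) ts); first by apply/andP; split; [by_count U | walks].
(* If the new ear has inner vertices, so does one of the arcs; if it is a chord, not being an edge
   of the cycle gives both arcs inner vertices. *)
rewrite size_rev; case: ts ts0 {U uts w ts1} => [/(_ erefl) tz|? ? _] /=; last first.
  by case: (y1) (y2) ys1 => [|? ?] [|? ?].
rewrite -tz in nsz; case: y1 nsz {w1 ys1} => [|h1 y1] nsz.
  by rewrite (@ear_rel_consecutive _ s (t :: y2) s [::] _ _ (rcons y2 s)) ?mem_head in nsz.
case: y2 nsz {w2 w3} => [|h2 y2] nsz //.
rewrite ear_rel_sym (@ear_rel_consecutive _ s ((h1 :: y1) ++ [:: t]) s (s :: h1 :: y1) _ _ [::]) ?mem_head // in nsz.
by rewrite rcons_cat.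
Qed.

(** Walking on from any edge yields a cycle; an edgeless graph is covered by the empty system. *)
Lemma critical_few_ears : few_ears.
Proof.
have [[s [z sz]]|noedge] := classic (exists s z : G, edge s z); last first.
  by exists [::], [::]; split=> // s z sz; case: noedge; exists s, z.
have [[xs [t [/eqP-> w uxs nX [_ /(_ erefl) xs1]]]]|[xs [y [ys [_ w uys _ ys1]]]]] :=
  @walk_extension (pred1 s) s z (eqxx s) sz.
- apply: (@cycle_few s xs) => //; apply/andP; split; last by walks.
  by rewrite /= cats0 uxs andbT; apply: contraNN nX; rewrite has_pred1.
- apply: (@cycle_few y ys) => //; apply/andP; split; last by walks.
  by_count uys.
Qed.

End Structure.

Theorem theorem7p1 :
  exists k : nat, 0 < k /\
    forall m : nat, 0 < m ->
    forall G : sgraph, bipartite G -> three_choosable_critical G ->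
      choosable G (4 * m * k) (2 * m * k).
Proof.
(* The bounds 2 and 4 are those of [few_ears], so [k] is fixed before [m] and [G]. *)
have [k k0 kP] := ear_system_choosable 2 4; exists k; split=> // m m0 G bip crit.
have [c cP] := bip; have [W [es [W2 es4 sys cov]]] := critical_few_ears crit cP.
exact: kP sys cov.
Qed.
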